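(* Let $\beta\in(0,1)$, $d\in\mathbb{N}$ with $d>2/\beta$, and let $\xi=(\xi_t)$ be a locally finite $(2,\beta)$-superprocess in $\mathbb{R}^d$ with arbitrary initial distribution (i.e. $\xi_0$ may be random). Then the following conditions are equivalent as $t\to\infty$: (i) $\xi_t\xrightarrow{d}0$; (ii) $\operatorname{supp}\xi_t\xrightarrow{d}\emptyset$; (iii) $\xi_0p_t\to0$ in probability.
   Context: Here $\xi_0p_t=\int p_t(x)\,\xi_0(dx)$ with $p_t(x)=(2\pi t)^{-d/2}e^{-|x|^2/(2t)}$. A $(2,\beta)$-superprocess $\xi=(\xi_t)_{t\ge0}$ in $\mathbb{R}^d$ is a vaguely rcll measure-valued strong Markov process with $E_\mu e^{-\xi_t f}=e^{-\mu v_t}$ (where $\mu v=\int v\,d\mu$) for suitable (e.g. bounded measurable) $f\ge0$, where $v$ is the unique (mild) solution of $\dot v=\frac12\Delta v-v^{1+\beta}$, $v_0=f$; for $\sigma$-finite initial measure $\mu$, it is constructed by additivity as a sum of countably many independent copies with finite initial measures summing to $\mu$. With a random initial measure $\xi_0$, the conditional law of $\xi$ given $\xi_0=\mu$ is $P_\mu$. Locally finite means that for every $t>0$, a.s., $\xi_tB<\infty$ for all bounded Borel sets $B$. Convergence $\xi_t\xrightarrow{d}0$ means $\xi_tB\to0$ in probability for every bounded Borel set $B$; $\operatorname{supp}\xi_t\xrightarrow{d}\emptyset$ means $1\{\xi_tB>0\}\to0$ in probability for every bounded Borel set $B$. *)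

(* Defs.v *)
From HB Require Import structures.
From mathcomp Require Import all_boot all_order all_algebra.
From mathcomp Require Import all_classical all_reals all_analysis.
From mathcomp Require Import measurable_realfun.

Set Implicit Arguments.
Unset Strict Implicit.
Unset Printing Implicit Defensive.

Import Order.TTheory GRing.Theory Num.Theory.
Import numFieldNormedType.Exports.

Local Open Scope classical_set_scope.
Local Open Scope ring_scope.

(* R^d is d.-tuple R with the library's product sigma-algebra, which is the
   Borel sigma-algebra of R^d. *)

Section lebesgue_tuple.
Context {R : realType}.

Definition cons_pair d (p : measurableTypeR R * d.-tuple R) : d.+1.-tuple R :=
  [tuple of p.1 :: p.2].

Lemma measurable_cons_pair d :
  measurable_fun [set: (measurableTypeR R * d.-tuple R)%type] (@cons_pair d).
Proof. exact: measurable_cons measurable_fst measurable_snd. Qed.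

Section cons_measure.
Context (d : nat) (m : {measure set (d.-tuple R) -> \bar R}).
Local Open Scope ereal_scope.

Definition cons_measure : set (d.+1.-tuple R) -> \bar R :=
  pushforward (lebesgue_measure \x^ m) (@cons_pair d).

Let mcons := @measurable_cons_pair d.

Let cons_measure0 : cons_measure set0 = 0.
Proof. by rewrite /cons_measure /pushforward preimage_set0 measure0. Qed.

Let cons_measure_ge0 A : 0 <= cons_measure A.
Proof. by rewrite /cons_measure /pushforward measure_ge0. Qed.

Let cons_measure_sigma_additive : semi_sigma_additive cons_measure.
Proof.
move=> F mF tF mUF; rewrite /cons_measure /pushforward preimage_bigcup.
apply: measure_semi_sigma_additive.
- by move=> n; rewrite -[X in measurable X]setTI; exact: mcons.
- apply/trivIsetP => /= i j _ _ ij; rewrite -preimage_setI.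
  by move/trivIsetP : tF => /(_ _ _ _ _ ij) ->//; rewrite preimage_set0.
- by rewrite -preimage_bigcup -[X in measurable X]setTI; exact: mcons.
Qed.

HB.instance Definition _ := isMeasure.Build _ _ _ cons_measure
  cons_measure0 cons_measure_ge0 cons_measure_sigma_additive.

End cons_measure.

Fixpoint lebesgue_tuple d : {measure set (d.-tuple R) -> \bar R} :=
  if d is d'.+1 then cons_measure (lebesgue_tuple d') else \d_[tuple].

End lebesgue_tuple.

Section heat.
Context {R : realType} {d : nat}.
Local Notation E := (d.-tuple R).
Implicit Types (t : R) (x y : E).

Definition sub_tuple x y : E := [tuple tnth x i - tnth y i | i < d].

Definition sqr_norm x : R := \sum_(i < d) tnth x i ^+ 2.

Definition heat_kernel t x : R :=
  (2 * pi * t) `^ (- (d%:R / 2)) * expR (- (sqr_norm x / (2 * t))).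

Definition heat_semigroup t (f : E -> R) x : \bar R :=
  \int[lebesgue_tuple d]_y (heat_kernel t (sub_tuple x y) * f y)%:E.

(* v_t + int_0^t T_{t-s} (v_s^{1+beta}) ds = T_t f: all the terms are
   nonnegative, so that nothing is subtracted in \bar R; the values of v at
   negative times are irrelevant. *)
Definition mild_solution (beta : R) (f : E -> R) (v : R -> E -> R) : Prop :=
  [/\ measurable_fun [set tx : R * E | 0 <= tx.1] (fun tx => v tx.1 tx.2),
      forall t x, 0 <= t -> 0 <= v t x,
      forall x, v 0 x = f x &
      forall t x, 0 < t ->
        ((v t x)%:E +
         \int[lebesgue_measure]_(s in `[0%R, t[)
           heat_semigroup (t - s) (fun y => (v s y `^ (1 + beta))%R) x
         = heat_semigroup t f x)%E].

Definition unique_mild_solution beta f v : Prop :=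
  mild_solution beta f v /\
  forall w, mild_solution beta f w -> forall t x, 0 <= t -> w t x = v t x.

End heat.

Section measure_valued_processes.
Context {R : realType} {d : nat}.
Local Notation E := (d.-tuple R).
Local Notation M := {measure set E -> \bar R}.

Definition bounded_tuple_set (B : set E) : Prop :=
  exists K : R, forall x, B x -> forall i, `|tnth x i| <= K.

Definition locally_finite (mu : M) : Prop :=
  forall B, measurable B -> bounded_tuple_set B -> (mu B < +oo)%E.

Definition measures_measurable : set (set M) :=
  <<s [set D | exists (B : set E) (Y : set (\bar R)),
        [/\ measurable B, measurable Y & D = [set mu : M | Y (mu B)]]] >>.

Definition paths_measurable : set (set (R -> M)) :=
  <<s [set C | exists (t : R) (B : set E) (Y : set (\bar R)),
        [/\ 0 <= t, measurable B, measurable Y &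
            C = [set x : R -> M | Y (x t B)]]] >>.

Definition vague_test (f : E -> R) : Prop :=
  [/\ continuous (fun r : 'rV[R]_d => f [tuple r ord0 i | i < d]),
      forall x, 0 <= f x & bounded_tuple_set [set x | f x != 0]].

Definition vaguely_rcll (x : R -> M) : Prop :=
  [/\ forall t, 0 <= t -> locally_finite (x t),
      forall t f, 0 <= t -> vague_test f ->
        (\int[x s]_y (f y)%:E)%E @[s --> t^'+] --> (\int[x t]_y (f y)%:E)%E &
      forall t, 0 < t -> exists2 nu : M, locally_finite nu &
        forall f, vague_test f ->
          (\int[x s]_y (f y)%:E)%E @[s --> t^'-] --> (\int[nu]_y (f y)%:E)%E].

Section process.
Context {dO : measure_display} {Omega : measurableType dO}.
Variables (P : probability Omega R) (X : R -> Omega -> M).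

Definition measurable_process : Prop :=
  forall t B, 0 <= t -> measurable B -> measurable_fun setT (fun w => X t w B).

Definition history (t : R) : set (set Omega) :=
  <<s [set A | exists (s : R) (B : set E) (Y : set (\bar R)),
        [/\ 0 <= s <= t, measurable B, measurable Y &
            A = [set w | Y (X s w B)]]] >>.

Definition stopping_time (tau : Omega -> \bar R) : Prop :=
  (forall w, 0 <= tau w)%E /\
  forall t, 0 <= t -> history t [set w | (tau w <= t%:E)%E].

Definition stopped_history (tau : Omega -> \bar R) (A : set Omega) : Prop :=
  measurable A /\
  forall t, 0 <= t -> history t (A `&` [set w | (tau w <= t%:E)%E]).

(* Q mu C is the probability of the set C of paths for the process started
   at mu. *)
Definition strong_markov (Q : M -> set (R -> M) -> \bar R) : Prop :=
  forall tau A C, stopping_time tau -> stopped_history tau A ->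
    paths_measurable C ->
    let F := A `&` [set w | (tau w < +oo)%E] in
    let post w := fun t => X (fine (tau w) + t) w in
    P (F `&` [set w | C (post w)]) =
    (\int[P]_(w in F) Q (X (fine (tau w)) w) C)%E.

Definition has_path_law (L : set (R -> M) -> \bar R) : Prop :=
  forall C, paths_measurable C -> P [set w | C (X ^~ w)] = L C.

Definition conditional_path_law (Q : M -> set (R -> M) -> \bar R) : Prop :=
  forall D C, measures_measurable D -> paths_measurable C ->
    P [set w | D (X 0 w) /\ C (X ^~ w)] =
    (\int[P]_(w in [set w | D (X 0 w)]) Q (X 0 w) C)%E.

(* E exp (- X_t f) = exp (- mu v_t), where exp (- oo) = 0 *)
Definition laplace_functional (beta : R) (mu : M) : Prop :=
  forall f : E -> R, measurable_fun setT f -> (forall x, 0 <= f x) ->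
    (exists K : R, forall x, f x <= K) ->
    exists2 v, unique_mild_solution beta f v &
      forall t, 0 <= t ->
        (\int[P]_w expeR (- \int[X t w]_x (f x)%:E)
         = expeR (- \int[mu]_x (v t x)%:E))%E.

End process.

Definition independent_processes {dO : measure_display}
    {Omega : measurableType dO} (P : probability Omega R)
    (X : nat -> R -> Omega -> M) : Prop :=
  forall (n : nat) (C : nat -> set (R -> M)),
    (forall i, paths_measurable (C i)) ->
    P [set w | forall i, (i < n)%N -> C i (X i ^~ w)] =
    (\prod_(i < n) P [set w | C i (X i ^~ w)])%E.

(* The values of a measure matter on measurable sets only. *)
Definition same_measure (mu nu : M) : Prop :=
  forall B, measurable B -> mu B = nu B.

Definition kernel_on_sigma_finite (Q : M -> set (R -> M) -> \bar R) : Prop :=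
  forall (C : set (R -> M)) (Y : set (\bar R)),
    paths_measurable C -> measurable Y ->
    exists2 D, measures_measurable D &
      forall mu : M, sigma_finite setT mu -> (D mu <-> Y (Q mu C)).

Definition superprocess_from (beta : R) (Q : M -> set (R -> M) -> \bar R)
    {dO : measure_display} {Omega : measurableType dO}
    (P : probability Omega R) (X : R -> Omega -> M) (mu : M) : Prop :=
  [/\ measurable_process X /\ has_path_law P X (Q mu),
      forall w, same_measure (X 0 w) mu,
      forall w, vaguely_rcll (X ^~ w),
      strong_markov P X Q &
      laplace_functional P X beta mu].

(* Q mu is the law P_mu of the (2,beta)-superprocess started at the
   sigma-finite measure mu; Q is arbitrary at the other measures. *)
Definition superprocess_laws (beta : R) (Q : M -> set (R -> M) -> \bar R) :
    Prop :=
  [/\ kernel_on_sigma_finite Q,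
      forall mu : M, (mu setT < +oo)%E ->
        exists (dO : measure_display) (Omega : measurableType dO)
          (P : probability Omega R) (X : R -> Omega -> M),
        superprocess_from beta Q P X mu &
      forall mu : M, sigma_finite setT mu ->
        exists (dO : measure_display) (Omega : measurableType dO)
          (P : probability Omega R) (X : nat -> R -> Omega -> M)
          (m : nat -> M),
        [/\ forall n, (m n setT < +oo)%E,
            same_measure (mseries m 0) mu,
            forall n, superprocess_from beta Q P (X n) (m n),
            independent_processes P X &
            has_path_law P (fun t w => mseries (fun n => X n t w) 0) (Q mu)]].

(* For infinite xi_0 the paths arise as infinite sums, so that regularity is
   only required of the summands; xi is prescribed through its law given xi_0. *)
Definition superprocess (beta : R) {dO : measure_display}
    {Omega : measurableType dO} (P : probability Omega R)
    (xi : R -> Omega -> M) : Prop :=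
  exists2 Q, superprocess_laws beta Q &
    [/\ measurable_process xi, forall w, sigma_finite setT (xi 0 w) &
        conditional_path_law P xi Q].

Definition locally_finite_process {dO : measure_display}
    {Omega : measurableType dO} (P : probability Omega R)
    (xi : R -> Omega -> M) : Prop :=
  forall t, 0 < t -> {ae P, forall w, locally_finite (xi t w)}.

End measure_valued_processes.

Definition cvg_to0_in_probability {R : realType} {dO : measure_display}
    {Omega : measurableType dO} (P : probability Omega R)
    (Z : R -> Omega -> \bar R) : Prop :=
  forall e : R, 0 < e ->
    P [set w | (e%:E <= `|Z t w|)%E] @[t --> +oo] --> (0 : \bar R)%E.

(* Main.v *)
From HB Require Import structures.
Require Import Defs.
From mathcomp Require Import all_boot all_order all_algebra.
From mathcomp Require Import all_classical all_reals all_analysis.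
From mathcomp Require Import measurable_realfun.
From mathcomp Require Import ring lra.

(** Let [p_t] be the heat kernel, [T_t] the heat semigroup and [V_t f] the mild
    solution with initial value [f] (here [cumulant beta f t]), so that
    [E_mu exp (- xi_t f) = exp (- mu (V_t f))]. The theorem follows from a
    two-sided comparison of [V_t (n 1_B)] with heat kernels.

    Upper bound ([cumulant_box_le_heat_kernel]): for a box [B] there is [C] with
    [V_(t+1) (n 1_B) <= C p_(t+9)] for all [n]. Letting [n] tend to infinity in the Laplace functional, the
    process started at [mu] charges [B] at time [t+1] with probability at most
    [C mu p_(t+9)] ([law_hitting_le]); an infinite [mu] is handled by the union
    bound over its finite summands. Hence (iii) implies (ii).
    The bound rests on two facts: [V_t f <= (beta t)^(-1/beta)], since this
    dominates the spatially constant solutions ([cumulant_cst_le]), and a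
    Gaussian decay of [V_1 (n 1_B)] away from [B], uniform in [n]. For the
    latter, the time interval is cut at the points [2^-k] and at each of them the
    solution is split into its parts inside and outside a box [B_k]; the boxes
    decrease to [B] and [B_k] exceeds [B_(k+1)] by [(3/4)^k]. The inner part is
    at most a constant times [2^(k/beta)], and the heat flow carries it across
    the gap within time [2^-(k+1)] only up to a factor [exp (- (9/8)^k / 4)],
    which beats [2^(k/beta)] summably. Splitting is allowed because [V_t] is
    subadditive ([cumulant_subadd]), which is read off from the Laplace
    functionals of the process started at [c delta_x] as [c] tends to [0].

    Lower bound ([cumulant_box1_ge]): as [d beta / 2 > 1], the integral of
    [(sup T_s f)^beta] over all [s > 0] converges, and it is at most [1/2] for a
    small multiple [f] of the indicator of the unit box. Then the reaction term
    removes at most half of [T_t f], so that [V_t f >= T_t f / 2], which is at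
    least a constant times [p_(t/2)]. Consequently, if [mu p_(t/2)] is not small,
    neither is the probability that [xi_t] puts a fixed mass on the unit box
    ([law_small_mass_le]); for infinite [mu] this uses the independence of the
    summands through [expectation_prod]. Hence (i) implies (iii).

    That (ii) implies (i) is clear, and both estimates extend to a random
    initial measure by integrating over its law ([path_law_mixture]). *)

Set Implicit Arguments.
Unset Strict Implicit.
Unset Printing Implicit Defensive.

Import Order.TTheory GRing.Theory Num.Theory.
Import numFieldNormedType.Exports.

Local Open Scope classical_set_scope.
Local Open Scope ring_scope.

(** * Lebesgue measure on tuples *)

Section lebesgue_tuple_theory.
Context {R : realType}.
Local Open Scope ereal_scope.

Definition tuple_box d (K : R) : set (d.-tuple R) :=
  [set x | forall i, (`|tnth x i| <= K)%R].

Lemma tuple_boxE d (K : R) :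
  tuple_box K = \bigcap_(i in [set: 'I_d])
    ((@tnth d R)^~ i @^-1` `[(- K)%R, K]%classic).
Proof.
apply/seteqP; split=> [x xK i _ /=|x xK i].
  by rewrite in_itv /= -ler_norml.
by rewrite ler_norml; have := xK i I; rewrite /= in_itv.
Qed.

Lemma measurable_tuple_box d (K : R) : measurable (@tuple_box d K).
Proof.
rewrite tuple_boxE; apply: fin_bigcap_measurable => // i _.
rewrite -[X in measurable X]setTI.
exact: (@measurable_tnth _ (measurableTypeR R) d i).
Qed.

Lemma tuple_box_cons d (K : R) :
  @cons_pair R d @^-1` tuple_box K = `[(- K)%R, K]%classic `*` tuple_box K.
Proof.
apply/seteqP; split=> [[a x] /= h|[a x] /= [ha hx] i].
  split; first by have := h ord0; rewrite tnth0 /= in_itv /= -ler_norml.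
  by move=> i; have := h (lift ord0 i); rewrite tnthS.
have [j ->|->] := unliftP ord0 i; first by rewrite tnthS; exact: hx.
by rewrite tnth0 ler_norml; move: ha; rewrite in_itv.
Qed.

Lemma lebesgue_tuple_box d (K : R) : (0 <= K)%R ->
  lebesgue_tuple d (tuple_box K) = ((K *+ 2) ^+ d)%:E.
Proof.
move=> K0; elim: d => [|d IH].
  by rewrite /= diracE expr0 mem_set// => -[].
rewrite /= /cons_measure /pushforward tuple_box_cons product_measure2E//=; last first.
  exact: measurable_tuple_box.
rewrite [X in _ * X]IH lebesgue_measure_itv /= lte_fin opprK.
case: ifPn => [_|]; first by rewrite exprS EFinM mulr2n.
rewrite -leNgt => K1; have -> : K = 0%R by lra.
by rewrite mul0rn exprS mul0r mul0e.
Qed.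

Lemma lebesgue_tuple_sigma_finite d : sigma_finite setT (@lebesgue_tuple R d).
Proof.
exists (fun n => tuple_box n%:R).
  apply/esym; rewrite -subTset => x _.
  have [M HM] : exists M : R, forall i, (`|tnth x i| <= M)%R.
    exists (\sum_i `|tnth x i|)%R => i.
    by rewrite (bigD1 i)//= lerDl sumr_ge0.
  exists (Num.truncn M).+1 => // i; apply: le_trans (HM i) _.
  by apply/ltW; exact: truncnS_gt.
move=> n; split; first exact: measurable_tuple_box.
by rewrite lebesgue_tuple_box// ltry.
Qed.

(** A constant head for the canonical structure of sigma-finite measures, which
    the Fubini theorems ask for. *)
Definition lebesgue_tuple_sf d : set (d.-tuple R) -> \bar R := @lebesgue_tuple R d.

HB.instance Definition _ d := Measure.on (@lebesgue_tuple_sf d).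
HB.instance Definition _ d := Measure_isSigmaFinite.Build _ _ _ (@lebesgue_tuple_sf d)
  (@lebesgue_tuple_sigma_finite d).

Lemma ge0_integral_cons_measure d
    (m : {sigma_finite_measure set (d.-tuple R) -> \bar R})
    (F : d.+1.-tuple R -> \bar R) :
  measurable_fun setT F -> (forall y, 0 <= F y) ->
  \int[cons_measure m]_y F y =
  \int[m]_y \int[lebesgue_measure]_a F [tuple of a :: y].
Proof.
move=> mF F0.
rewrite /= /cons_measure ge0_integral_pushforward//; last first.
  exact: measurable_cons_pair.
rewrite preimage_setT.
transitivity (\int[lebesgue_measure \x m]_x (F \o @cons_pair R d) x).
  apply: eq_measure_integral => A mA _.
  apply/esym/product_measure_unique => // B C mB mC.
  exact: product_measure2E.
rewrite fubini_tonelli2//=; last first.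
  by apply: measurableT_comp => //; exact: measurable_cons_pair.
Qed.

Lemma ge0_integral_lebesgue_tupleS d (F : d.+1.-tuple R -> \bar R) :
  measurable_fun setT F -> (forall y, 0 <= F y) ->
  \int[lebesgue_tuple d.+1]_y F y =
  \int[lebesgue_tuple d]_y \int[lebesgue_measure]_a F [tuple of a :: y].
Proof. exact: (@ge0_integral_cons_measure d (@lebesgue_tuple_sf d)). Qed.

(** Reduces the Gaussian integrals on [R^d] to one-dimensional ones. *)
Lemma prod_integral_lebesgue_tuple d (g : 'I_d -> R -> R) :
  (forall i, measurable_fun setT (g i)) -> (forall i a, (0 <= g i a)%R) ->
  \int[lebesgue_tuple d]_y (\prod_(i < d) g i (tnth y i))%:E =
  \prod_(i < d) \int[lebesgue_measure]_a (g i a)%:E.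
Proof.
elim: d g => [|d IH] g mg g0.
  rewrite /= integral_dirac//; first by rewrite diracT mul1e !big_ord0.
  rewrite [X in measurable_fun _ X](_ : _ = cst 1)//.
  by apply/funext => y; rewrite big_ord0.
have mprod n (h : 'I_n -> R -> R) : (forall i, measurable_fun setT (h i)) ->
    measurable_fun setT (fun y : n.-tuple R => \prod_(i < n) h i (tnth y i))%R.
  move=> mh; apply: measurable_prod => i _.
  apply: measurableT_comp => //.
  exact: (@measurable_tnth _ (measurableTypeR R)).
rewrite ge0_integral_lebesgue_tupleS; first last.
- by move=> y; rewrite lee_fin prodr_ge0.
- by apply/measurable_EFinP; exact: mprod.
rewrite big_ord_recl -IH//.
rewrite -ge0_integralZl//; first last.
- by apply: integral_ge0 => a _; rewrite lee_fin.
- by move=> y _; rewrite lee_fin prodr_ge0.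
- by apply/measurable_EFinP; apply: (mprod d (fun i => g (lift ord0 i))).
apply: eq_integral => y _.
rewrite -ge0_integralZr//; first last.
- by rewrite lee_fin prodr_ge0.
- by move=> a _; rewrite lee_fin.
- by apply/measurable_EFinP; exact: mg.
apply: eq_integral => a _.
rewrite -EFinM big_ord_recl tnth0; congr (_ * _)%:E.
by apply: eq_bigr => i _; rewrite tnthS.
Qed.

End lebesgue_tuple_theory.


(** * The heat kernel *)

Section gaussian.
Context {R : realType}.
Implicit Types (s t x y z : R).

Lemma normal_pdf_sqrtE t x y : 0 < t ->
  normal_pdf x (Num.sqrt t) y =
  (2 * pi * t) `^ (- 2^-1) * expR (- ((x - y) ^+ 2 / (2 * t))).
Proof.
move=> t0; have st0 : Num.sqrt t != 0 by rewrite gt_eqF// sqrtr_gt0.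
rewrite normal_pdfE// /normal_peak /normal_fun sqr_sqrtr ?ltW//.
congr (_ * expR _).
  rewrite powRN powR12_sqrt; last by rewrite !mulr_ge0 ?pi_ge0 ?ltW.
  by congr (Num.sqrt _)^-1; rewrite -mulr_natl; ring.
rewrite mulNr -mulr_natl; congr (- (_ * _)); ring.
Qed.

(** Completing the square in [y]: the product of the two densities is a density
    in [y] with the weighted mean, up to the factor that does not depend on [y]. *)
Lemma normal_pdf_mul s t x y z : 0 < s -> 0 < t ->
  normal_pdf x (Num.sqrt s) y * normal_pdf y (Num.sqrt t) z =
  normal_pdf x (Num.sqrt (s + t)) z *
  normal_pdf ((t * x + s * z) / (s + t)) (Num.sqrt (s * t / (s + t))) y.
Proof.
move=> s0 t0; have st0 : 0 < s + t by rewrite addr_gt0.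
have u0 : 0 < s * t / (s + t) by rewrite divr_gt0// mulr_gt0.
have c0 : 0 < 2 * pi :> R by rewrite mulr_gt0// pi_gt0.
rewrite !normal_pdf_sqrtE// mulrACA [RHS]mulrACA -!expRD; congr (_ * expR _).
  have p0 (a : R) : 0 < a -> 0 <= 2 * pi * a by move=> a0; rewrite ltW// mulr_gt0.
  rewrite -!powRM ?p0//; congr (_ `^ _).
  by field; rewrite gt_eqF.
by field; rewrite !gt_eqF//= addrC.
Qed.

Lemma integral_normal_pdf_mul s t x z : 0 < s -> 0 < t ->
  (\int[lebesgue_measure]_y
    (normal_pdf x (Num.sqrt s) y * normal_pdf y (Num.sqrt t) z)%:E =
  (normal_pdf x (Num.sqrt (s + t)) z)%:E)%E.
Proof.
move=> s0 t0.
under eq_integral do rewrite normal_pdf_mul// EFinM.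
rewrite ge0_integralZl//.
- by rewrite integral_normal_pdf mule1.
- by apply/measurable_EFinP; exact: measurable_normal_pdf.
- by move=> y _; rewrite lee_fin normal_pdf_ge0.
- by rewrite lee_fin normal_pdf_ge0.
Qed.

End gaussian.

(** Inversion is not continuous at [0], but [x^-1 = x * (x^2)^-1] reduces it to
    a power of a nonnegative number. *)
Lemma measurable_inv (R : realType) :
  measurable_fun [set: measurableTypeR R] (@GRing.inv R).
Proof.
have -> : @GRing.inv R = (fun x => x * (x ^+ 2) `^ (-1)).
  apply/funext => x; rewrite powR_inv1 ?sqr_ge0//.
  have [->|x0] := eqVneq x 0; first by rewrite mul0r invr0.
  by rewrite expr2 invfM mulrA divff// mul1r.
apply: measurable_funM => //.
apply: (@measurableT_comp _ _ _ _ _ _ (@powR R ^~ _)).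
  exact: measurable_powR.
exact: measurable_funX.
Qed.

Section heat_theory.
Context {R : realType} {d : nat}.
Local Notation E := (d.-tuple R).
Implicit Types (s t : R) (x y z : E) (F G : E -> \bar R).

Lemma heat_kernel_ge0 t x : 0 <= heat_kernel t x.
Proof. by rewrite mulr_ge0 ?powR_ge0 ?expR_ge0. Qed.

(** The coordinates separate, so that integrals against the kernel factor. *)
Lemma heat_kernel_prod t x y : 0 < t -> heat_kernel t (sub_tuple x y) =
  \prod_(i < d) normal_pdf (tnth x i) (Num.sqrt t) (tnth y i).
Proof.
move=> t0; under eq_bigr do rewrite normal_pdf_sqrtE//.
rewrite big_split/= prodr_const card_ord /heat_kernel; congr (_ * _).
  rewrite -powR_mulrn ?powR_ge0// -powRrM; congr (_ `^ _); ring.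
rewrite -expR_sum; congr expR; rewrite /sqr_norm mulr_suml -sumrN.
by apply: eq_bigr => i _; rewrite /sub_tuple tnth_mktuple.
Qed.

Definition zero_tuple : E := [tuple 0 | i < d].

Lemma sub_tuple0 x : sub_tuple x zero_tuple = x.
Proof. by apply: eq_from_tnth => i; rewrite !tnth_mktuple subr0. Qed.

Lemma integral_heat_kernel t x : 0 < t ->
  (\int[lebesgue_tuple d]_y (heat_kernel t (sub_tuple x y))%:E = 1)%E.
Proof.
move=> t0; under eq_integral do rewrite heat_kernel_prod//.
rewrite (@prod_integral_lebesgue_tuple R d
  (fun i => normal_pdf (tnth x i) (Num.sqrt t))).
- by rewrite big1// => i _; rewrite integral_normal_pdf.
- by move=> i; exact: measurable_normal_pdf.
- by move=> i a; exact: normal_pdf_ge0.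
Qed.

Lemma chapman_kolmogorov s t x z : 0 < s -> 0 < t ->
  (\int[lebesgue_tuple d]_y
    (heat_kernel s (sub_tuple x y) * heat_kernel t (sub_tuple y z))%:E
  = (heat_kernel (s + t) (sub_tuple x z))%:E)%E.
Proof.
move=> s0 t0.
under eq_integral do rewrite !heat_kernel_prod// -big_split/=.
have mpdf u a : u != 0 -> measurable_fun setT (fun y : R => normal_pdf y u a).
  move=> u0.
  have -> : (fun y : R => normal_pdf y u a) = normal_pdf a u.
    apply/funext => y; rewrite !normal_pdfE// /normal_fun.
    by rewrite -[in LHS]sqrrN opprB.
  exact: measurable_normal_pdf.
rewrite (@prod_integral_lebesgue_tuple R d
  (fun i a => normal_pdf (tnth x i) (Num.sqrt s) a *
              normal_pdf a (Num.sqrt t) (tnth z i))).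
- rewrite heat_kernel_prod ?addr_gt0//.
  under eq_bigr do rewrite integral_normal_pdf_mul//.
  by rewrite prodEFin.
- by move=> i; apply: measurable_funM => //;
    [exact: measurable_normal_pdf|apply: mpdf; rewrite gt_eqF// sqrtr_gt0].
- by move=> i a; rewrite mulr_ge0 ?normal_pdf_ge0.
Qed.


Lemma heat_semigroup_kernel s t x : 0 < s -> 0 < t ->
  heat_semigroup s (heat_kernel t) x = (heat_kernel (s + t) x)%:E.
Proof.
move=> s0 t0; have := chapman_kolmogorov x zero_tuple s0 t0.
rewrite sub_tuple0 => <-.
by apply: eq_integral => y _; rewrite sub_tuple0.
Qed.

Local Notation W := (measurableTypeR R * (E * E))%type.

Lemma measurable_heat_kernel_sub : measurable_fun [set: W]
  (fun p => heat_kernel p.1 (sub_tuple p.2.1 p.2.2)).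
Proof.
have m1 : measurable_fun [set: W] (fun p => p.1 : R) by exact: measurable_fst.
have mx i : measurable_fun [set: W] (fun p => tnth p.2.1 i).
  apply: (@measurableT_comp _ _ _ _ _ _ (@tnth _ R ^~ i)).
    exact: (@measurable_tnth _ (measurableTypeR R)).
  exact: (measurableT_comp measurable_fst measurable_snd).
have my i : measurable_fun [set: W] (fun p => tnth p.2.2 i).
  apply: (@measurableT_comp _ _ _ _ _ _ (@tnth _ R ^~ i)).
    exact: (@measurable_tnth _ (measurableTypeR R)).
  exact: (measurableT_comp measurable_snd measurable_snd).
apply: measurable_funM.
  apply: (@measurableT_comp _ _ _ _ _ _ (@powR R ^~ _)).
    exact: measurable_powR.
  exact: measurable_funM.
apply: measurableT_comp => //; apply: measurableT_comp => //.
apply: measurable_funM; last first.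
  apply: (@measurableT_comp _ _ _ _ _ _ (@GRing.inv R)).
    exact: measurable_inv.
  exact: measurable_funM.
apply: measurable_sum => i.
under eq_fun do rewrite /sub_tuple tnth_mktuple.
by apply: measurable_funX; exact: measurable_funB.
Qed.

End heat_theory.


(** * The heat semigroup on nonnegative functions *)

Section heat_operator.
Context {R : realType} {d : nat}.
Local Notation E := (d.-tuple R).
Implicit Types (s t : R) (x y z : E) (F G : E -> \bar R).
Local Open Scope ereal_scope.

(** The heat semigroup on [\bar R]-valued functions: it can be iterated and
    applied to time integrals before these are known to be finite. *)
Definition heat_op t F x : \bar R :=
  \int[lebesgue_tuple d]_y ((heat_kernel t (sub_tuple x y))%:E * F y).

Lemma sqr_norm_ge0 x : (0 <= sqr_norm x)%R.
Proof. by rewrite sumr_ge0// => i _; rewrite sqr_ge0. Qed.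

Lemma heat_semigroupE t (f : E -> R) x :
  heat_semigroup t f x = heat_op t (EFin \o f) x.
Proof. by apply: eq_integral => y _; rewrite EFinM. Qed.

Lemma heat_op_ge0 t F x : (forall y, 0 <= F y) -> 0 <= heat_op t F x.
Proof.
by move=> F0; apply: integral_ge0 => y _; rewrite mule_ge0// lee_fin heat_kernel_ge0.
Qed.

Lemma measurable_heat_kernel_subr t x :
  measurable_fun [set: E] (fun y => heat_kernel t (sub_tuple x y)).
Proof.
exact: (measurableT_comp measurable_heat_kernel_sub
  (measurableT_comp (pair1_measurable (t : measurableTypeR R)) (pair1_measurable x))).
Qed.

Lemma measurable_heat_kernel_subl t y :
  measurable_fun [set: E] (fun x => heat_kernel t (sub_tuple x y)).
Proof.
exact: (measurableT_comp measurable_heat_kernel_sub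
  (measurableT_comp (pair1_measurable (t : measurableTypeR R)) (pair2_measurable y))).
Qed.

Lemma measurable_heat_kernel t : measurable_fun [set: E] (heat_kernel t).
Proof.
have := measurable_heat_kernel_subl t zero_tuple.
by under eq_fun do rewrite sub_tuple0.
Qed.

Lemma measurable_heat_op_integrand t F x : measurable_fun setT F ->
  measurable_fun setT (fun y => (heat_kernel t (sub_tuple x y))%:E * F y).
Proof.
move=> mF; apply: emeasurable_funM => //.
by apply/measurable_EFinP; exact: measurable_heat_kernel_subr.
Qed.

Lemma le_heat_op t F G x : measurable_fun setT F -> measurable_fun setT G ->
  (forall y, 0 <= F y) -> (forall y, F y <= G y) ->
  heat_op t F x <= heat_op t G x.
Proof.
move=> mF mG F0 FG; apply: ge0_le_integral => //.
- by move=> y _; rewrite mule_ge0// lee_fin heat_kernel_ge0.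
- exact: measurable_heat_op_integrand.
- exact: measurable_heat_op_integrand.
- by move=> y _; rewrite lee_wpmul2l// lee_fin heat_kernel_ge0.
Qed.

Lemma heat_opD t F G x : measurable_fun setT F -> measurable_fun setT G ->
  (forall y, 0 <= F y) -> (forall y, 0 <= G y) ->
  heat_op t (F \+ G) x = heat_op t F x + heat_op t G x.
Proof.
move=> mF mG F0 G0; rewrite -ge0_integralD//.
- by apply: eq_integral => y _; rewrite muleDr// ge0_adde_def ?inE.
- by move=> y _; rewrite mule_ge0// lee_fin heat_kernel_ge0.
- exact: measurable_heat_op_integrand.
- by move=> y _; rewrite mule_ge0// lee_fin heat_kernel_ge0.
- exact: measurable_heat_op_integrand.
Qed.

Lemma heat_opZ t (k : R) F x : measurable_fun setT F ->
  (forall y, 0 <= F y) -> (0 <= k)%R ->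
  heat_op t (fun y => k%:E * F y) x = k%:E * heat_op t F x.
Proof.
move=> mF F0 k0; rewrite -ge0_integralZl//.
- by apply: eq_integral => y _; rewrite muleCA.
- exact: measurable_heat_op_integrand.
- by move=> y _; rewrite mule_ge0// lee_fin heat_kernel_ge0.
Qed.

Lemma heat_op_cst t (k : R) x : (0 < t)%R -> (0 <= k)%R ->
  heat_op t (cst k%:E) x = k%:E.
Proof.
move=> t0 k0; rewrite /heat_op ge0_integralZr//.
- by rewrite integral_heat_kernel// mul1e.
- by apply/measurable_EFinP; exact: measurable_heat_kernel_subr.
- by move=> y _; rewrite lee_fin heat_kernel_ge0.
Qed.

Lemma heat_op_kernel s t x : (0 < s)%R -> (0 < t)%R ->
  heat_op s (EFin \o heat_kernel t) x = (heat_kernel (s + t) x)%:E.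
Proof. by move=> s0 t0; rewrite -heat_semigroupE heat_semigroup_kernel. Qed.

(** The form in which the Duhamel integrand depends on time and space. *)
Lemma measurable_heat_op_joint (u : R) (F : (measurableTypeR R * E)%type -> \bar R) :
  measurable_fun setT F -> (forall p, 0 <= F p) ->
  measurable_fun [set: (measurableTypeR R * E)%type]
    (fun p => heat_op (u - p.1)%R (fun y => F (p.1, y)) p.2).
Proof.
move=> mF F0.
apply: (@measurable_fun_fubini_tonelli_F _ _ _ _ R (@lebesgue_tuple_sf R d)
  (fun q : (measurableTypeR R * E) * E =>
   (heat_kernel (u - q.1.1) (sub_tuple q.1.2 q.2))%:E * F (q.1.1, q.2))); last first.
  by move=> q; rewrite mule_ge0// lee_fin heat_kernel_ge0.
have m1 : measurable_fun [set: (measurableTypeR R * E) * E] (fun q => q.1.1).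
  exact: (measurableT_comp measurable_fst measurable_fst).
have m2 : measurable_fun [set: (measurableTypeR R * E) * E] (fun q => q.1.2).
  exact: (measurableT_comp measurable_snd measurable_fst).
apply: emeasurable_funM.
  apply/measurable_EFinP.
  have mm : measurable_fun [set: (measurableTypeR R * E) * E]
      (fun q => ((u - q.1.1)%R : measurableTypeR R, (q.1.2, q.2))).
    apply: measurable_fun_pair; last exact: measurable_fun_pair.
    exact: measurable_funB.
  exact: (measurableT_comp measurable_heat_kernel_sub mm).
by apply: (measurableT_comp mF); exact: measurable_fun_pair.
Qed.

Lemma measurable_heat_op t F : measurable_fun setT F -> (forall y, 0 <= F y) ->
  measurable_fun setT (heat_op t F).
Proof.
move=> mF F0.
have mFs : measurable_fun [set: (measurableTypeR R * E)%type] (F \o snd).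
  exact: measurableT_comp.
have := measurableT_comp (measurable_heat_op_joint t mFs (fun p => F0 p.2))
  (pair1_measurable (0%R : measurableTypeR R)).
by rewrite /comp/= subr0.
Qed.

Lemma heat_op_heat_op s t F x : (0 < s)%R -> (0 < t)%R ->
  measurable_fun setT F -> (forall y, 0 <= F y) ->
  heat_op s (heat_op t F) x = heat_op (s + t) F x.
Proof.
move=> s0 t0 mF F0; rewrite /heat_op.
have mst : measurable_fun [set: E * E] (fun p =>
    (heat_kernel s (sub_tuple x p.1) * heat_kernel t (sub_tuple p.1 p.2))%:E).
  apply/measurable_EFinP; apply: measurable_funM.
    exact: (measurableT_comp (measurable_heat_kernel_subr s x) measurable_fst).
  exact: (measurableT_comp measurable_heat_kernel_sub
    (pair1_measurable (t : measurableTypeR R))).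
have k0 u y z : 0 <= (heat_kernel u (sub_tuple y z))%:E.
  by rewrite lee_fin heat_kernel_ge0.
transitivity (\int[@lebesgue_tuple_sf R d]_y \int[@lebesgue_tuple_sf R d]_z
   ((heat_kernel s (sub_tuple x y) * heat_kernel t (sub_tuple y z))%:E * F z)).
  apply: eq_integral => y _; rewrite -ge0_integralZl//.
  - by apply: eq_integral => z _; rewrite EFinM muleA.
  - exact: measurable_heat_op_integrand.
  - by move=> z _; rewrite mule_ge0.
rewrite (@fubini_tonelli _ _ _ _ R (@lebesgue_tuple_sf R d) (@lebesgue_tuple_sf R d) (fun p =>
   (heat_kernel s (sub_tuple x p.1) * heat_kernel t (sub_tuple p.1 p.2))%:E * F p.2)).
- apply: eq_integral => z _; rewrite /= ge0_integralZr//.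
  + by rewrite -chapman_kolmogorov.
  + exact: (measurableT_comp mst (pair2_measurable z)).
  + by move=> y _; rewrite EFinM mule_ge0.
- apply: emeasurable_funM => //; exact: (measurableT_comp mF measurable_snd).
- by move=> p; rewrite mule_ge0// EFinM mule_ge0.
Qed.

Lemma measurable_time_restrict (D : set R) (G : R -> E -> \bar R) :
  measurable (D : set (measurableTypeR R)) ->
  measurable_fun [set: (measurableTypeR R * E)%type] (fun p => G p.1 p.2) ->
  measurable_fun [set: (measurableTypeR R * E)%type]
    (fun p => ((G ^~ p.2) \_ D) p.1).
Proof.
move=> mD mG.
have -> : (fun p : measurableTypeR R * E => ((G ^~ p.2) \_ D) p.1) =
    (fun p => G p.1 p.2 * (\1_D p.1)%:E).
  apply/funext => p; rewrite patchE indicE; case: ifP => _;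
  by rewrite ?mule1 ?mule0.
apply: emeasurable_funM => //; apply/measurable_EFinP.
exact: (measurableT_comp (measurable_indic mD) measurable_fst).
Qed.

Lemma measurable_time_integral (D : set R) (G : R -> E -> \bar R) :
  measurable (D : set (measurableTypeR R)) ->
  measurable_fun [set: (measurableTypeR R * E)%type] (fun p => G p.1 p.2) ->
  (forall r y, 0 <= G r y) ->
  measurable_fun setT (fun y => \int[lebesgue_measure]_(r in D) G r y).
Proof.
move=> mD mG G0; under eq_fun do rewrite integral_mkcond.
apply: (@measurable_fun_fubini_tonelli_G _ _ _ _ R lebesgue_measure
  (fun p : measurableTypeR R * E => ((G ^~ p.2) \_ D) p.1)).
  exact: measurable_time_restrict.
by move=> p; rewrite patchE; case: ifP.
Qed.

Lemma heat_op_time_integral t (D : set R) (G : R -> E -> \bar R) x :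
  measurable (D : set (measurableTypeR R)) ->
  measurable_fun [set: (measurableTypeR R * E)%type] (fun p => G p.1 p.2) ->
  (forall r y, 0 <= G r y) ->
  heat_op t (fun y => \int[lebesgue_measure]_(r in D) G r y) x =
  \int[lebesgue_measure]_(r in D) heat_op t (G r) x.
Proof.
move=> mD mG G0; rewrite /heat_op.
have k0 u y z : 0 <= (heat_kernel u (sub_tuple y z))%:E.
  by rewrite lee_fin heat_kernel_ge0.
have GD0 r y : 0 <= ((G ^~ y) \_ D) r by rewrite patchE; case: ifP.
have mGD : measurable_fun [set: (measurableTypeR R * E)%type]
    (fun p => ((G ^~ p.2) \_ D) p.1).
  exact: measurable_time_restrict.
have mk : measurable_fun [set: (measurableTypeR R * E)%type] (fun p =>
   (heat_kernel t (sub_tuple x p.2))%:E * ((G ^~ p.2) \_ D) p.1).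
  apply: emeasurable_funM => //; apply/measurable_EFinP.
  exact: (measurableT_comp (measurable_heat_kernel_subr t x) measurable_snd).
transitivity (\int[@lebesgue_tuple_sf R d]_y \int[lebesgue_measure]_r
   ((heat_kernel t (sub_tuple x y))%:E * ((G ^~ y) \_ D) r)).
  apply: eq_integral => y _; rewrite integral_mkcond -ge0_integralZl//.
  exact: (measurableT_comp mGD (pair2_measurable y)).
apply: etrans.
  apply/esym/(@fubini_tonelli _ _ _ _ R lebesgue_measure (@lebesgue_tuple_sf R d) (fun p =>
   (heat_kernel t (sub_tuple x p.2))%:E * ((G ^~ p.2) \_ D) p.1)) => //.
  by move=> p; rewrite mule_ge0.
rewrite [RHS]integral_mkcond; apply: eq_integral => r _.
rewrite [RHS]patchE; case: ifPn => rD.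
  by apply: eq_integral => y _; rewrite patchE rD.
by rewrite integral0_eq// => y _; rewrite patchE (negbTE rD) mule0.
Qed.

(** The kernel is at most its value at the origin. *)
Lemma le_heat_op_sup t (f : E -> R) x : (0 < t)%R -> measurable_fun setT f ->
  (forall y, 0 <= f y)%R ->
  heat_op t (EFin \o f) x <=
  ((2 * pi * t) `^ (- (d%:R / 2)))%:E * \int[lebesgue_tuple d]_y (f y)%:E.
Proof.
move=> t0 mf f0; rewrite -ge0_integralZl//; first last.
- by rewrite lee_fin powR_ge0.
- by move=> y _; rewrite lee_fin.
- exact/measurable_EFinP.
apply: ge0_le_integral => //.
- by move=> y _; rewrite mule_ge0// lee_fin// heat_kernel_ge0.
- by apply: measurable_heat_op_integrand; exact/measurable_EFinP.
- by apply: emeasurable_funM => //; exact/measurable_EFinP.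
move=> y _; rewrite lee_wpmul2r// lee_fin// /heat_kernel ler_piMr ?powR_ge0//.
rewrite expR_le1 oppr_le0 divr_ge0 ?sqr_norm_ge0// mulr_ge0// ltW//.
Qed.

End heat_operator.

(** * Integrals on the line *)

Section real_integrals.
Context {R : realType}.

Definition translate (s : R) : measurableTypeR R -> measurableTypeR R :=
  fun r => r + s.

Lemma measurable_translate s : measurable_fun setT (translate s).
Proof. exact: measurable_funD. Qed.

HB.instance Definition _ s := isMeasurableFun.Build _ _ _ _ (translate s)
  (measurable_translate s).

Lemma lebesgue_measure_translate (s : R) (A : set (measurableTypeR R)) :
  measurable A ->
  pushforward lebesgue_measure (translate s) A = lebesgue_measure A.
Proof.
move=> mA; apply/esym/lebesgue_measure_unique => //= _ [[a b]] _ <-.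
rewrite /pushforward (_ : _ @^-1` _ = `](a - s), (b - s)]%classic); last first.
  by apply/seteqP; split => r /=; rewrite !in_itv/= /translate ltrBlDr lerBrDr.
rewrite !lebesgue_measure_itv/= !lte_fin ltrD2r -!EFinB.
by case: ifPn => // _; congr EFin; ring.
Qed.

Lemma ge0_integral_translate (s t : R) (g : R -> \bar R) :
  measurable_fun [set: measurableTypeR R] g -> (forall r, 0 <= g r)%E ->
  (\int[lebesgue_measure]_(r in `[s, (t + s)%R[) g r =
   \int[lebesgue_measure]_(r in `[0%R, t[) g (r + s)%R)%E.
Proof.
move=> mg g0.
have -> : `[0%R, t[%classic = translate s @^-1` `[s, (t + s)[.
  by apply/seteqP; split => r /=; rewrite !in_itv/= /translate lerDr ltrD2r.
rewrite -(ge0_integral_pushforward (measurable_translate s))//; last first.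
  exact: measurable_funTS.
apply: eq_measure_integral => A mA _.
exact/esym/lebesgue_measure_translate.
Qed.

(** Used both for the constant solutions of the equation, with [c = beta], and
    for the convergence of the integral of [(1 + s)^(- d beta / 2)]. *)
Lemma integral_powR_affine (b c q t : R) : 0 < b -> 0 < c -> 0 < q -> 0 < t ->
  (\int[lebesgue_measure]_(s in `[0%R, t[) ((b + c * s) `^ (- (q + 1)))%:E =
   ((b `^ (- q) - (b + c * t) `^ (- q)) / (c * q))%:E)%E.
Proof.
move=> b0 c0 q0 t0.
have pos (s : R) : 0 <= s -> 0 < b + c * s.
  by move=> s0; rewrite ltr_pwDl// mulr_ge0// ltW.
have cq : c * q != 0 by rewrite gt_eqF// mulr_gt0.
pose F s := - (b + c * s) `^ (- q) / (c * q).
have dF (s : R) : 0 <= s -> is_derive s (1:R) F ((b + c * s) `^ (- (q + 1))).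
  move=> s0.
  have h1 : is_derive s (1:R) (fun s : R => b + c * s) c.
    by apply: is_derive_eq; rewrite add0r mul1r; exact: mulr1.
  have h2 := is_derive1_powR (- q) (pos _ s0).
  have h3 := @is_derive1_comp _ (fun r => r `^ (- q)) (fun s : R => b + c * s) _ _ _ h2 h1.
  have -> : F = ((- (c * q)^-1) \*: ((fun r => r `^ (- q)) \o (fun s : R => b + c * s))).
    by apply/funext => r; rewrite /F /= mulNr -mulrN mulrC.
  apply: is_derive_eq.
  rewrite -[in RHS]mulN1r mulrDr mulN1r mulr1 /GRing.scale/=; field.
  by rewrite !gt_eqF.
rewrite integral_itv_bndo_bndc; last first.
  apply/measurable_EFinP/measurable_funTS.
  apply: (@measurableT_comp _ _ _ _ _ _ (@powR R ^~ _)).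
    exact: measurable_powR.
  by apply: measurable_funD => //; exact: measurable_funM.
rewrite (@continuous_FTC2 _ _ F)//.
- by rewrite -EFinB /F mulr0 addr0; congr EFin; field; rewrite !gt_eqF.
- apply/continuous_in_subspaceT => s; rewrite inE/= in_itv/= => /andP[s0 _].
  apply: (@continuous_comp _ _ _ (fun s => b + c * s) (@powR R ^~ _)).
    by apply: cvgD; [exact: cvg_cst|apply: cvgM; [exact: cvg_cst|exact: cvg_id]].
  apply/differentiable_continuous/derivable1_diffP.
  by have [] := is_derive1_powR (- (q + 1)) (pos _ s0).
- have cF (s : R) : 0 <= s -> {for s, continuous F}.
    move=> s0; apply/differentiable_continuous/derivable1_diffP.
    by have [] := dF _ s0.
  split.
  + by move=> s; rewrite in_itv/= => /andP[/ltW s0 _]; have [] := dF _ s0.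
  + exact/cvg_at_right_filter/cF.
  + exact/cvg_at_left_filter/cF/ltW.
- move=> s; rewrite in_itv/= => /andP[/ltW s0 _].
  by rewrite derive1E; have [_ ->] := dF _ s0.
Qed.

End real_integrals.

(** * Mild solutions *)

Lemma fin_num_addeI (R : realType) (a x y : \bar R) : a \is a fin_num ->
  (a + x = a + y)%E -> x = y.
Proof.
by move=> afin axy; rewrite -(addeK x afin) (addeC x) axy (addeC a) addeK.
Qed.

Opaque heat_op heat_semigroup.
Section mild_solutions.
Context {R : realType} {d : nat}.
Variable beta : R.
Hypothesis beta_gt0 : 0 < beta.
Local Notation E := (d.-tuple R).
Local Notation TE := (measurableTypeR R * E)%type.
Implicit Types (s t : R) (x y : E) (f : E -> R) (v : R -> E -> R).

(** The values of [v] at negative times are arbitrary; cutting them off makes the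
    reaction term jointly measurable on the whole space. *)
Definition reaction v s y : \bar R :=
  if 0 <= s then ((v s y) `^ (1 + beta))%:E else 0%E.

Lemma reaction_ge0 v s y : (0 <= reaction v s y)%E.
Proof. by rewrite /reaction; case: ifP => //; rewrite lee_fin powR_ge0. Qed.

Lemma measurable_reaction f v : mild_solution beta f v ->
  measurable_fun [set: TE] (fun p => reaction v p.1 p.2).
Proof.
move=> [mv _ _ _].
pose D := [set tx : TE | 0 <= tx.1].
have mD : measurable D.
  rewrite (_ : D = fst @^-1` `[0, +oo[%classic); last first.
    by apply/seteqP; split=> p /=; rewrite /D/= in_itv/= andbT.
  rewrite -[X in measurable X]setTI.
  exact: (@measurable_fst _ _ (measurableTypeR R) E).
have -> : (fun p : TE => reaction v p.1 p.2) =
    (fun p => ((v p.1 p.2) `^ (1 + beta))%:E) \_ D.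
  apply/funext => p; rewrite patchE /reaction.
  have [p0|p0] := boolP (0 <= p.1); first by rewrite mem_set.
  by rewrite memNset//= => h; rewrite h in p0.
apply/(measurable_restrictT _ mD)/measurable_EFinP.
have mv' : measurable_fun D (fun tx : TE => v tx.1 tx.2).
  exact mv.
exact: (measurableT_comp (measurable_powR (1 + beta)) mv').
Qed.

Lemma measurable_reaction_at f v s : mild_solution beta f v ->
  measurable_fun setT (reaction v s).
Proof.
move=> /measurable_reaction mv.
exact: (measurableT_comp mv (pair1_measurable (s : measurableTypeR R))).
Qed.

Lemma measurable_mild f v t : mild_solution beta f v -> 0 <= t ->
  measurable_fun setT (v t).
Proof.
move=> [mv _ _ _] t0.
have h := @measurable_comp _ _ _ _ _ _ [set tx : TE | 0 <= tx.1]
  (fun tx => v tx.1 tx.2) setT (fun y => (t : measurableTypeR R, y)).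
apply: h => //.
- rewrite (_ : mkset _ = fst @^-1` `[0, +oo[%classic); last first.
    by apply/seteqP; split=> p /=; rewrite in_itv/= andbT.
  rewrite -[X in measurable X]setTI.
  exact: (@measurable_fst _ _ (measurableTypeR R) E).
- by move=> _ [y _ <-].
- exact: (pair1_measurable (t : measurableTypeR R)).
Qed.

Lemma mild_eq f v t x : mild_solution beta f v -> 0 < t ->
  ((v t x)%:E +
    \int[lebesgue_measure]_(s in `[0%R, t[) heat_op (t - s) (reaction v s) x
   = heat_op t (EFin \o f) x)%E.
Proof.
move=> [_ _ _ eqv] t0; have := eqv t x t0; rewrite heat_semigroupE => <-.
congr (_ + _)%E.
apply: eq_integral => s; rewrite inE/= in_itv/= => /andP[s0 _].
by rewrite heat_semigroupE /reaction s0.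
Qed.

Lemma reaction_integral_ge0 v t x (D : set R) :
  (0 <= \int[lebesgue_measure]_(s in D) heat_op (t - s) (reaction v s) x)%E.
Proof.
by apply: integral_ge0 => s _; apply: heat_op_ge0 => y; exact: reaction_ge0.
Qed.

Lemma mild_le_heat f v t x : mild_solution beta f v -> 0 < t ->
  ((v t x)%:E <= heat_op t (EFin \o f) x)%E.
Proof.
move=> mv t0; rewrite -(mild_eq _ mv)// leeDl// reaction_integral_ge0//.
Qed.

Lemma mild_bounded f v (K : R) : mild_solution beta f v ->
  measurable_fun setT f -> (forall y, 0 <= f y) ->
  (forall y, f y <= K) -> forall t x, 0 <= t -> v t x <= K.
Proof.
move=> mv mf f0 fK t x; rewrite le_eqVlt => /predU1P[<-|t0].
  by case: mv => _ _ -> _; exact: fK.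
rewrite -lee_fin (le_trans (mild_le_heat _ mv t0))//.
have K0 : 0 <= K by apply: le_trans (fK x); exact: f0.
rewrite -(heat_op_cst x t0 K0); apply: le_heat_op => //.
exact/measurable_EFinP.
Qed.

(** Apply [T_t] to the equation at time [s]: this turns [T_s f] into
    [T_(t+s) f] and the Duhamel integral over [[0, s[] into the first part of the
    one at time [t + s]. That part is finite and cancels. *)
Lemma mild_shift f v (K s : R) : mild_solution beta f v ->
  measurable_fun setT f -> (forall y, 0 <= f y) -> (forall y, f y <= K) ->
  0 < s -> mild_solution beta (v s) (fun t => v (t + s)).
Proof.
move=> mv mf f0 fK s0; have [mv1 v0 _ _] := mv; split.
- have h := @measurable_comp _ _ _ _ _ _ [set tx : TE | 0 <= tx.1]
    (fun tx => v tx.1 tx.2) [set tx : TE | 0 <= tx.1]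
    (fun p => (p.1 + s : measurableTypeR R, p.2)).
  apply: h => //.
  + rewrite (_ : mkset _ = fst @^-1` `[0, +oo[%classic); last first.
      by apply/seteqP; split=> p /=; rewrite in_itv/= andbT.
    rewrite -[X in measurable X]setTI.
    exact: (@measurable_fst _ _ (measurableTypeR R) E).
  + by move=> _ [p /= p0 <-]/=; rewrite addr_ge0// ltW.
  + apply: measurable_funTS; apply: measurable_fun_pair => //.
    exact: measurable_funD.
- by move=> t x t0; apply: v0; rewrite addr_ge0// ltW.
- by move=> x; rewrite add0r.
move=> t x t0; have ts0 : 0 < t + s by rewrite addr_gt0.
have mr := measurable_reaction mv.
have mop u : measurable_fun [set: TE]
    (fun p => heat_op (u - p.1) (reaction v p.1) p.2).
  by apply: (@measurable_heat_op_joint _ _ u (fun p => reaction v p.1 p.2)) => // p;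
    exact: reaction_ge0.
have op0 u r y : (0 <= heat_op u (reaction v r) y)%E.
  by apply: heat_op_ge0 => z; exact: reaction_ge0.
have mf' : measurable_fun setT (EFin \o f) by exact/measurable_EFinP.
have mvs : measurable_fun setT (EFin \o v s).
  by apply/measurable_EFinP; apply: (measurable_mild mv); exact: ltW.
(* the equation at time [s], propagated by time [t] *)
have eqs : (heat_op t (EFin \o v s) x +
    \int[lebesgue_measure]_(r in `[0%R, s[) heat_op (t + s - r) (reaction v r) x
    = heat_op (t + s) (EFin \o f) x)%E.
  rewrite -heat_op_heat_op//.
  have -> : heat_op s (EFin \o f) = (EFin \o v s) \+ (fun y =>
      \int[lebesgue_measure]_(r in `[0%R, s[) heat_op (s - r) (reaction v r) y)%E.
    by apply/funext => y; rewrite -(mild_eq _ mv).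
  rewrite heat_opD//; last 3 first.
  - apply: (@measurable_time_integral _ _ _
      (fun r y => heat_op (s - r) (reaction v r) y)).
    + by [].
    + exact: (mop s).
    + by move=> r y; exact: op0.
  - by move=> y; rewrite lee_fin v0// ltW.
  - by move=> y; exact: reaction_integral_ge0.
  rewrite (@heat_op_time_integral _ _ t `[0%R, s[%classic
    (fun r => heat_op (s - r) (reaction v r)) x (measurable_itv _) (mop s)
    (fun r y => op0 (s - r) r y)).
  congr (_ + _)%E.
  apply: eq_integral => r; rewrite inE/= in_itv/= => /andP[r0 rs].
  have sr0 : 0 < s - r by rewrite subr_gt0.
  rewrite (@heat_op_heat_op _ _ t (s - r) (reaction v r) x t0 sr0
    (measurable_reaction_at r mv) (reaction_ge0 v r)).
  by rewrite addrA.
set A := (\int[lebesgue_measure]_(r in `[0%R, s[) _)%E in eqs.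
have Afin : A \is a fin_num.
  rewrite ge0_fin_numE; last exact: reaction_integral_ge0.
  apply: (@le_lt_trans _ _ K%:E); last by rewrite ltry.
  have K0 : 0 <= K by apply: le_trans (fK x).
  rewrite -(heat_op_cst x ts0 K0).
  apply: (@le_trans _ _ (heat_op (t + s) (EFin \o f) x)).
    by rewrite -eqs leeDr// heat_op_ge0// => y; rewrite lee_fin v0// ltW.
  by apply: le_heat_op => // y; rewrite /= lee_fin.
have := mild_eq x mv ts0; rewrite -eqs.
rewrite (_ : `[0%R, (t + s)[%classic = `[0%R, s[ `|` `[s, (t + s)[); last first.
  have sts : s <= t + s by rewrite lerDr ltW.
  by rewrite -itv_bndbnd_setU// bnd_simp// ltW.
have mx u : measurable_fun [set: measurableTypeR R]
    (fun r => heat_op (u - r) (reaction v r) x).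
  exact: (measurableT_comp (mop u) (pair2_measurable x)).
rewrite ge0_integral_setU//=; last 2 first.
- by apply: measurable_funTS; exact: mx.
- apply/disj_setPRL => r /=; rewrite !in_itv/= => /andP[sr _] /andP[_].
  by rewrite ltNge sr.
rewrite -/A ge0_integral_translate// => eqts.
rewrite heat_semigroupE; apply: (fin_num_addeI Afin).
rewrite [RHS]addeC -eqts addeCA; congr (_ + (_ + _))%E.
apply: eq_integral => r; rewrite inE/= in_itv/= => /andP[r0 _].
have -> : t + s - (r + s) = t - r by ring.
rewrite heat_semigroupE; congr (heat_op _ _ _).
by apply/funext => y; rewrite /reaction addr_ge0// ltW.
Qed.


(** Since [v_s <= T_s f <= b s], the reaction [v_s^(1+beta)] is at most
    [(b s)^beta T_s f], and [T_(t-s) T_s f = T_t f] no longer depends on [s]: the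
    Duhamel integral is at most [T_t f] times the integral of [b^beta]. *)
Lemma mild_ge_half_heat f v (b : R -> R) t x : mild_solution beta f v ->
  measurable_fun setT f -> (forall y, 0 <= f y) -> 0 < t ->
  measurable_fun [set: measurableTypeR R] b -> (forall s, 0 <= b s) ->
  (forall s y, 0 < s -> (heat_op s (EFin \o f) y <= (b s)%:E)%E) ->
  (\int[lebesgue_measure]_(s in `[0%R, t[) (b s `^ beta)%:E <= 2^-1%:E)%E ->
  (heat_op t (EFin \o f) x <= (2 * v t x)%:E)%E.
Proof.
move=> mv mf f0 t0 mb b0 fb intb; have [_ v0 _ _] := mv.
have mf' : measurable_fun setT (EFin \o f) by exact/measurable_EFinP.
have f0' y : (0 <= (EFin \o f) y)%E by rewrite /= lee_fin.
set H := heat_op t (EFin \o f) x.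
have H0 : (0 <= H)%E by exact: heat_op_ge0.
have Hfin : H \is a fin_num.
  by rewrite ge0_fin_numE// (le_lt_trans (fb t x t0))// ltry.
have mbb : measurable_fun [set: measurableTypeR R] (fun s => (b s `^ beta)%:E).
  by apply/measurable_EFinP; exact: (measurableT_comp (measurable_powR beta)).
have mx : measurable_fun [set: measurableTypeR R]
    (fun r => heat_op (t - r) (reaction v r) x).
  have mop := @measurable_heat_op_joint R d t
    (fun p => reaction v p.1 p.2) (measurable_reaction mv)
    (fun p => reaction_ge0 v p.1 p.2).
  exact: (measurableT_comp mop (pair2_measurable x)).
have le_reaction s : 0 < s -> s < t ->
    (heat_op (t - s) (reaction v s) x <= (b s `^ beta)%:E * H)%E.
  move=> s0 st.
  have ts0 : 0 < t - s by rewrite subr_gt0.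
  have mTs : measurable_fun setT (heat_op s (EFin \o f)).
    exact: measurable_heat_op.
  have Ts0 y : (0 <= heat_op s (EFin \o f) y)%E by exact: heat_op_ge0.
  have -> : H = heat_op (t - s) (heat_op s (EFin \o f)) x.
    by rewrite (heat_op_heat_op x ts0 s0 mf' f0') subrK.
  rewrite -(heat_opZ (t - s) x mTs Ts0 (powR_ge0 _ _)).
  apply: (le_heat_op _ _ (measurable_reaction_at s mv)).
  - exact: measurable_funeM.
  - exact: reaction_ge0.
  move=> y; rewrite /reaction (ltW s0).
  have vs0 : 0 <= v s y by apply: v0; exact: ltW.
  have vT := mild_le_heat y mv s0.
  rewrite powRD; last by rewrite gt_eqF//= addr_gt0.
  rewrite powRr1// mulrC EFinM; apply: lee_pmul => //.
    by rewrite lee_fin powR_ge0.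
  rewrite lee_fin ge0_ler_powR ?nnegrE ?(ltW beta_gt0)//.
  by rewrite -lee_fin (le_trans vT)// fb.
have : (H <= (v t x)%:E + 2^-1%:E * H)%E.
  rewrite {1}/H -(mild_eq x mv t0) leeD2l//.
  rewrite -integral_itv_obnd_cbnd; last exact: measurable_funTS.
  apply: (@le_trans _ _ (\int[lebesgue_measure]_(s in `[0%R, t[)
    ((b s `^ beta)%:E * H))%E); last first.
    rewrite ge0_integralZr//; first by rewrite lee_wpmul2r.
    + exact: measurable_funTS.
    + by move=> s _; rewrite lee_fin powR_ge0.
  rewrite -[leRHS]integral_itv_obnd_cbnd; last first.
    by apply: measurable_funTS; exact: emeasurable_funM.
  apply: ge0_le_integral => //.
  - by move=> s _; apply: heat_op_ge0; exact: reaction_ge0.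
  - exact: measurable_funTS.
  - by apply: measurable_funTS; exact: emeasurable_funM.
  by move=> s /=; rewrite in_itv/= => /andP[]; exact: le_reaction.
rewrite -(fineK Hfin) -EFinM -EFinD !lee_fin; lra.
Qed.

(** For a constant initial value the equation is the ordinary one,
    [w' = - w^(1+beta)], which separates. *)
Lemma mild_cst (n : R) : 0 < n -> mild_solution beta (fun _ : E => n)
  (fun t _ => (n `^ (- beta) + beta * t) `^ (- beta^-1)).
Proof.
move=> n0; have b0 : 0 < n `^ (- beta) by exact: powR_gt0.
have mw : measurable_fun [set: measurableTypeR R]
    (fun t => (n `^ (- beta) + beta * t) `^ (- beta^-1)).
  apply: (@measurableT_comp _ _ _ _ _ _ (@powR R ^~ _)).
    exact: measurable_powR.
  by apply: measurable_funD => //; exact: measurable_funM.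
have nE : (n `^ (- beta)) `^ (- beta^-1) = n.
  by rewrite -powRrM mulrNN divff ?gt_eqF// powRr1// ltW.
split.
- apply: measurable_funTS.
  exact: (measurableT_comp mw (@measurable_fst _ _ (measurableTypeR R) E)).
- by move=> t x _; exact: powR_ge0.
- by move=> x; rewrite mulr0 addr0.
move=> t x t0; rewrite heat_semigroupE (heat_op_cst x t0 (ltW n0)).
rewrite [X in (_ + X)%E](_ : _ = \int[lebesgue_measure]_(s in `[0%R, t[)
    ((n `^ (- beta) + beta * s) `^ (- (beta^-1 + 1)))%:E)%E; last first.
  apply: eq_integral => s; rewrite inE/= in_itv/= => /andP[s0 st].
  rewrite heat_semigroupE -powRrM heat_op_cst ?powR_ge0// ?subr_gt0//.
  by congr (_ `^ _)%:E; field; rewrite gt_eqF.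
rewrite integral_powR_affine// ?invr_gt0// divff ?gt_eqF// divr1 nE -EFinD.
by congr EFin; ring.
Qed.

End mild_solutions.


(** * Cumulants of the superprocess *)

Lemma measurable_expeR (R : realType) : measurable_fun [set: \bar R] (@expeR R).
Proof.
have -> : @expeR R = (fun x => if x == -oo%E then 0%E else er_map expR x).
  by apply/funext => -[r| |].
apply: measurable_fun_ifT => //; last first.
  exact: (@measurable_er_map _ (measurableTypeR R) R _ (@measurable_expR R)).
apply: (measurable_fun_bool true) => //=; rewrite setTI (_ : _ @^-1` _ = [set -oo%E])//.
by apply/seteqP; split => x /= /eqP.
Qed.

Section cumulants.
Context {R : realType} {d : nat}.
Local Notation E := (d.-tuple R).
Local Notation M := {measure set E -> \bar R}.
Variables (beta : R) (Q : M -> set (R -> M) -> \bar R).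
Hypothesis beta_gt0 : 0 < beta.
Hypothesis HQ : superprocess_laws beta Q.
Implicit Types (s t : R) (x y : E) (f g : E -> R).

Definition bounded_test f :=
  [/\ measurable_fun setT f, forall x, 0 <= f x & exists K, forall x, f x <= K].

(** The log-Laplace functional of the process started at a point mass. *)
Definition cumulant f : R -> E -> R :=
  xget (fun _ _ => 0) [set v | unique_mild_solution beta f v].

Section random_measure.
Context {dO : measure_display} {Omega : measurableType dO}.
Variables (P : probability Omega R) (X : R -> Omega -> M).
Hypothesis mX : measurable_process X.

Lemma measurable_process_integral t (F : E -> \bar R) : 0 <= t ->
  measurable_fun setT F -> (forall x, 0 <= F x)%E ->
  measurable_fun setT (fun w => \int[X t w]_x F x)%E.
Proof.
move=> t0 mF F0.
by apply: measurable_fun_integral_kernel => // U mU; exact: mX.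
Qed.

Lemma measurable_process_expeR t f : 0 <= t -> measurable_fun setT f ->
  (forall x, 0 <= f x) ->
  measurable_fun setT (fun w => expeR (- \int[X t w]_x (f x)%:E))%E.
Proof.
move=> t0 mf f0; apply: measurableT_comp; first exact: measurable_expeR.
apply: measurableT_comp => //; apply: measurable_process_integral => //.
by apply/measurable_EFinP.
Qed.

End random_measure.

Lemma superprocess_from_dirac (c : {nonneg R}) x :
  exists (dO : measure_display) (Omega : measurableType dO)
    (P : probability Omega R) (X : R -> Omega -> M),
    superprocess_from beta Q P X (mscale c (\d_x)).
Proof.
have [_ Hfin _] := HQ; apply: Hfin.
by rewrite -[ltLHS]/((c%:num)%:E * \d_x [set: E])%E diracT mule1 ltry.
Qed.

Lemma cumulantP f : bounded_test f -> unique_mild_solution beta f (cumulant f).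
Proof.
move=> [mf f0 fK].
have [dO [Om [P [X [_ _ _ _ lap]]]]] := superprocess_from_dirac 0%:nng zero_tuple.
have [v hv _] := lap f mf f0 fK.
by rewrite /cumulant; apply: (@xgetPex _ _ [set v | unique_mild_solution beta f v]); exists v.
Qed.


Lemma cumulant_mild f : bounded_test f -> mild_solution beta f (cumulant f).
Proof. by move=> /cumulantP[]. Qed.

Lemma cumulant_unique f v t x : bounded_test f -> mild_solution beta f v ->
  0 <= t -> v t x = cumulant f t x.
Proof. by move=> /cumulantP[_ h] mv t0; exact: h. Qed.

Lemma cumulant_ge0 f t x : bounded_test f -> 0 <= t -> 0 <= cumulant f t x.
Proof. by move=> /cumulant_mild[_ h _ _]; exact: h. Qed.

Lemma measurable_cumulant f t : bounded_test f -> 0 <= t ->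
  measurable_fun setT (cumulant f t).
Proof. by move=> /cumulant_mild h t0; exact: (measurable_mild h). Qed.

Lemma cumulant_bounded f t : bounded_test f -> 0 <= t ->
  bounded_test (cumulant f t).
Proof.
move=> bf t0; have [mf f0 [K fK]] := bf; split.
- exact: measurable_cumulant.
- by move=> x; exact: cumulant_ge0.
- exists K => x; exact: (mild_bounded (cumulant_mild bf)).
Qed.

Lemma cumulant_le_heat f t x : bounded_test f -> 0 < t ->
  ((cumulant f t x)%:E <= heat_op t (EFin \o f) x)%E.
Proof. by move=> /cumulant_mild h t0; exact: (mild_le_heat x h t0). Qed.

(** The shifted solution solves the equation started at [cumulant f s], whose
    solution is unique. *)
Lemma cumulant_flow f s t x : bounded_test f -> 0 < s -> 0 <= t ->
  cumulant f (t + s) x = cumulant (cumulant f s) t x.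
Proof.
move=> bf s0 t0; have [mf f0 [K fK]] := bf.
apply: (@cumulant_unique (cumulant f s) (fun t => cumulant f (t + s))) => //.
  by apply: cumulant_bounded => //; exact: ltW.
exact: (mild_shift (cumulant_mild bf) mf f0 fK).
Qed.

Lemma superprocess_from_laplace {dO : measure_display}
    {Omega : measurableType dO} (P : probability Omega R)
    (X : R -> Omega -> M) mu f t :
  superprocess_from beta Q P X mu -> bounded_test f -> 0 <= t ->
  (\int[P]_w expeR (- \int[X t w]_x (f x)%:E) =
   expeR (- \int[mu]_x (cumulant f t x)%:E))%E.
Proof.
move=> [_ _ _ _ lap] bf t0; have [mf f0 fK] := bf.
have [v [mv _] ->//] := lap f mf f0 fK.
congr (expeR (- _)); apply: eq_integral => x _; congr EFin.
exact: cumulant_unique.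
Qed.

(** Starting at [c delta_x] makes a pointwise value of the cumulant visible in a
    Laplace functional; small [c] linearizes it. *)
Lemma dirac_laplace (c : R) x : 0 <= c ->
  exists (dO : measure_display) (Omega : measurableType dO)
    (P : probability Omega R) (X : R -> Omega -> M),
    measurable_process X /\ forall f t, bounded_test f -> 0 <= t ->
    (\int[P]_w expeR (- \int[X t w]_x (f x)%:E) =
     (expR (- (c * cumulant f t x)))%:E)%E.
Proof.
move=> c0; have [dO [Om [P [X hX]]]] := superprocess_from_dirac (NngNum c0) x.
exists dO, Om, P, X; split; first by case: hX => -[].
move=> f t bf t0; rewrite (superprocess_from_laplace hX)//.
have mc : measurable_fun setT (fun x => (cumulant f t x)%:E).
  by apply/measurable_EFinP; exact: measurable_cumulant.
rewrite ge0_integral_mscale//; last by move=> y _; rewrite lee_fin cumulant_ge0.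
by rewrite integral_dirac// diracT mul1e.
Qed.

(** Comparison without a maximum principle: a larger test function has a smaller
    Laplace functional. *)
Lemma le_cumulant f g t x : bounded_test f -> bounded_test g -> 0 <= t ->
  (forall y, f y <= g y) -> cumulant f t x <= cumulant g t x.
Proof.
move=> bf bg t0 fg; have [mf f0 _] := bf; have [mg g0 _] := bg.
have [dO [Om [P [X [mX lap]]]]] := dirac_laplace x (@ler01 R).
have := lap f t bf t0; have := lap g t bg t0; rewrite !mul1r => Eg Ef.
suff : (\int[P]_w expeR (- \int[X t w]_x (g x)%:E) <=
        \int[P]_w expeR (- \int[X t w]_x (f x)%:E))%E.
  by rewrite Ef Eg lee_fin ler_expR lerN2.
apply: ge0_le_integral => //.
- by move=> w _; exact: expeR_ge0.
- exact: measurable_process_expeR.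
- exact: measurable_process_expeR.
move=> w _; rewrite lee_expeR leeN2; apply: ge0_le_integral => //.
- by move=> y _; rewrite lee_fin.
- exact/measurable_EFinP.
- exact/measurable_EFinP.
- by move=> y _; rewrite lee_fin.
Qed.

Lemma bounded_testD f g : bounded_test f -> bounded_test g ->
  bounded_test (fun y => f y + g y).
Proof.
move=> [mf f0 [K fK]] [mg g0 [L gL]]; split.
- exact: measurable_funD.
- by move=> x; rewrite addr_ge0.
- by exists (K + L) => x; rewrite lerD.
Qed.

(** This is [(1 - exp (- a)) * (1 - exp (- b)) >= 0]. *)
Lemma expeRN_superadd (a b : \bar R) : (0 <= a -> 0 <= b ->
  expeR (- a) + expeR (- b) <= expeR (- (a + b)) + 1)%E.
Proof.
move: a b => [a| |] [b| |]//= a0 b0; rewrite ?adde0 ?add0e ?lexx//.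
- rewrite -!EFinD lee_fin opprD expRD.
  have h1 : expR (- a) <= 1 by rewrite expR_le1 oppr_le0 -lee_fin.
  have h2 : expR (- b) <= 1 by rewrite expR_le1 oppr_le0 -lee_fin.
  nra.
- by rewrite lee_fin expR_le1 oppr_le0 -lee_fin.
- by rewrite lee_fin expR_le1 oppr_le0 -lee_fin.
Qed.

Lemma cumulant_scaled_subadd (c : R) f g t x : 0 <= c ->
  bounded_test f -> bounded_test g -> 0 <= t ->
  expR (- (c * cumulant f t x)) + expR (- (c * cumulant g t x)) <=
  expR (- (c * cumulant (fun y => f y + g y) t x)) + 1.
Proof.
move=> c0 bf bg t0; have bfg := bounded_testD bf bg.
have [mf f0 _] := bf; have [mg g0 _] := bg; have [mfg fg0 _] := bfg.
have [dO [Om [P [X [mX lap]]]]] := dirac_laplace x c0.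
suff : (\int[P]_w expeR (- \int[X t w]_x (f x)%:E) +
        \int[P]_w expeR (- \int[X t w]_x (g x)%:E) <=
        \int[P]_w expeR (- \int[X t w]_x (f x + g x)%:E) + 1)%E.
  rewrite (lap f t bf t0) (lap g t bg t0) (lap _ t bfg t0).
  by move=> h; rewrite -lee_fin; exact h.
have -> : (1 = \int[P]_w cst 1%:E w)%E.
  by rewrite integral_cst// [X in (_ * X)%E]probability_setT mule1.
rewrite -!ge0_integralD//; first last.
- exact: measurable_process_expeR.
- by move=> w _; exact: expeR_ge0.
- exact: measurable_process_expeR.
- by move=> w _; exact: expeR_ge0.
- exact: measurable_process_expeR.
- by move=> w _; exact: expeR_ge0.
apply: ge0_le_integral => //.
- by move=> w _; rewrite adde_ge0// expeR_ge0.
- by apply: emeasurable_funD; exact: measurable_process_expeR.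
- by apply: emeasurable_funD => //; exact: measurable_process_expeR.
move=> w _; under [X in (_ <= expeR (- X) + _)%E]eq_integral do rewrite EFinD.
rewrite ge0_integralD//; first last.
- exact/measurable_EFinP.
- by move=> y _; rewrite lee_fin.
- exact/measurable_EFinP.
- by move=> y _; rewrite lee_fin.
by apply: expeRN_superadd; apply: integral_ge0 => y _; rewrite lee_fin.
Qed.

(** Divide by [c] and let [c --> 0], where [(1 - exp (- c a)) / c --> a]. *)
Lemma subadd_of_scaled (a b e : R) : 0 <= a -> 0 <= b -> 0 <= e ->
  (forall c, 0 <= c ->
    expR (- (c * a)) + expR (- (c * b)) <= expR (- (c * e)) + 1) ->
  e <= a + b.
Proof.
move=> a0 b0 e0 H; apply/ler_addgt0Pr => r r0.
have e1 : 0 < 1 + e by rewrite ltr_pwDl.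
pose c := r / (1 + e) ^+ 2.
(* [c] is small enough for the quadratic error of the exponential *)
have c0 : 0 < c by rewrite divr_gt0// exprn_gt0.
have ce2 : c * e ^+ 2 <= r.
  rewrite /c mulrAC ler_pdivrMr ?exprn_gt0// ler_pM2l//.
  by nra.
have Hc := H c (ltW c0).
have ha := expR_ge1Dx (- (c * a)); have hb := expR_ge1Dx (- (c * b)).
have he : expR (- (c * e)) <= 1 - c * e + (c * e) ^+ 2.
  have ce0 : 0 <= c * e by rewrite mulr_ge0// ltW.
  rewrite expRN -[leLHS]mul1r ler_pdivrMr ?expR_gt0//.
  have y1 := expR_ge1Dx (c * e); move: (c * e) ce0 y1 => y y0 y1.
  have z0 : 0 <= 1 - y + y ^+ 2 by nra.
  have z1 := ler_wpM2l z0 y1.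
  apply: le_trans z1; rewrite (_ : _ * _ = 1 + y ^+ 3); last by ring.
  by rewrite lerDl exprn_ge0.
have : c * e <= c * (a + b + r).
  have : c * (c * e ^+ 2) <= c * r by rewrite ler_pM2l.
  nra.
by rewrite ler_pM2l.
Qed.

Lemma cumulant_subadd f g t x : bounded_test f -> bounded_test g -> 0 <= t ->
  cumulant (fun y => f y + g y) t x <= cumulant f t x + cumulant g t x.
Proof.
move=> bf bg t0; have bfg := bounded_testD bf bg.
apply: subadd_of_scaled; try exact: cumulant_ge0.
by move=> c c0; exact: cumulant_scaled_subadd.
Qed.

(** The solution started at a constant [n >= f] is
    [(n^(-beta) + beta t)^(-1/beta)], bounded independently of [n]: this is where
    the nonlinearity enters. *)
Lemma cumulant_cst_le f t x : bounded_test f -> 0 < t ->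
  cumulant f t x <= (beta * t) `^ (- beta^-1).
Proof.
move=> bf t0; have [mf f0 [K fK]] := bf.
(* a constant above [f] that is also positive, as [mild_cst] requires *)
pose n := Num.max 1 K.
have n0 : 0 < n by rewrite lt_max ltr01.
have bn : bounded_test (fun _ => n).
  by split => // [x'|]; [exact: ltW|exists n].
apply: le_trans (le_cumulant x bf bn (ltW t0) _) _.
  by move=> y; rewrite le_max fK orbT.
rewrite -(cumulant_unique x bn (mild_cst beta_gt0 n0) (ltW t0)).
have bt : 0 < beta * t by rewrite mulr_gt0.
rewrite !(powRN _ beta^-1) lef_pV2 ?posrE ?powR_gt0 ?addr_gt0 ?powR_gt0//.
have pn : 0 < n `^ (- beta) by exact: powR_gt0.
have sum0 := addr_gt0 pn bt.
apply: ge0_ler_powR; rewrite ?nnegrE ?invr_ge0 ?(ltW bt) ?(ltW beta_gt0) ?(ltW sum0)//.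
by rewrite lerDr ltW.
Qed.

End cumulants.

(** * Heat flow out of a box *)

Section gaussian_tail.
Context {R : realType} {d : nat}.
Local Notation E := (d.-tuple R).
Implicit Types (s t : R) (x y : E).

(** The exponential only grows with the time, and the normalizing factors have
    the ratio [(t / s)^(d / 2)]. *)
Lemma heat_kernel_le_dilate s t x : 0 < s -> s <= t ->
  heat_kernel s x <= (t / s) `^ (d%:R / 2) * heat_kernel t x.
Proof.
move=> s0 st; have t0 : 0 < t := lt_le_trans s0 st.
have p2 (r : R) : 0 < r -> 0 < 2 * pi * r by move=> r0; rewrite !mulr_gt0// pi_gt0.
have -> : heat_kernel s x = (t / s) `^ (d%:R / 2) *
    ((2 * pi * t) `^ (- (d%:R / 2)) * expR (- (sqr_norm x / (2 * s)))).
  rewrite mulrA /heat_kernel; congr (_ * _).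
  rewrite !powRN (_ : 2 * pi * t = 2 * pi * s * (t / s)); last first.
    by field; rewrite gt_eqF.
  have ts : 0 < t / s by rewrite divr_gt0.
  rewrite (powRM _ (ltW (p2 _ s0)) (ltW ts)) invfM mulrCA divff ?mulr1//.
  by rewrite gt_eqF// powR_gt0.
rewrite ler_pM2l ?powR_gt0 ?divr_gt0//; apply: ler_wpM2l; first exact: powR_ge0.
rewrite ler_expR lerN2 ler_wpM2l ?sqr_norm_ge0// lef_pV2 ?posrE ?mulr_gt0//.
by rewrite ler_pM2l.
Qed.

Lemma sqr_norm_le_double x y :
  sqr_norm x <= 2 * sqr_norm (sub_tuple x y) + 2 * sqr_norm y.
Proof.
rewrite /sqr_norm !mulr_sumr -big_split/=; apply: ler_sum => i _.
rewrite /sub_tuple tnth_mktuple; move: (tnth x i) (tnth y i) => a b.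
rewrite -subr_ge0 (_ : _ - _ = (a - 2 * b) ^+ 2) ?sqr_ge0//; ring.
Qed.

Lemma sqr_norm_box (K : R) y : 0 <= K -> tuple_box K y -> sqr_norm y <= d%:R * K ^+ 2.
Proof.
move=> K0 yK; rewrite /sqr_norm.
apply: le_trans (_ : \sum_(i < d) K ^+ 2 <= _); last first.
  by rewrite sumr_const card_ord mulr_natl.
apply: ler_sum => i _; rewrite -real_normK ?num_real//.
by rewrite ler_pXn2r ?nnegrE// yK.
Qed.

(** One coordinate of [x] already exceeds the box by [delta]. *)
Lemma sqr_norm_box_gap (rho delta : R) x y : 0 <= delta ->
  ~ tuple_box (rho + delta) x -> tuple_box rho y ->
  delta ^+ 2 <= sqr_norm (sub_tuple x y).
Proof.
move=> d0 /existsNP[i /negP]; rewrite -ltNge => xi /(_ i) yi.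
rewrite /sqr_norm (bigD1 i)//= -[leLHS]addr0 lerD//; last first.
  by rewrite sumr_ge0// => j _; rewrite sqr_ge0.
rewrite /sub_tuple tnth_mktuple -[leRHS]real_normK ?num_real//.
rewrite ler_pXn2r ?nnegrE//.
have := ler_normD (tnth x i - tnth y i) (tnth y i); rewrite subrK; lra.
Qed.

(** The constant of [heat_kernel_off_box]: doubling the time, the points [y] of the
    box, and the normalization of [heat_kernel 8]. *)
Definition tail_const (rho : R) : R :=
  2 `^ (d%:R / 2) * expR (d%:R * rho ^+ 2 / 8) * (2 * pi * 8) `^ (d%:R / 2).

Lemma tail_const_gt0 rho : 0 < tail_const rho.
Proof.
by rewrite !mulr_gt0 ?expR_gt0 ?powR_gt0// ?mulr_gt0// pi_gt0.
Qed.

(** Doubling the time frees the factor [exp (- |x - y|^2 / (4 h))]. Half of it gives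
    the gap factor, as [|x - y| >= delta]; the other half is at most
    [exp (- |x - y|^2 / 8)], which is a Gaussian in [x] since [y] is bounded. The
    remaining kernel of time [2 h] keeps the bound integrable in [y]. *)
Lemma heat_kernel_off_box (h rho rho' delta : R) x y :
  0 < h -> h <= 1 -> 0 <= rho -> rho <= rho' -> 0 <= delta ->
  ~ tuple_box (rho + delta) x -> tuple_box rho y ->
  heat_kernel h (sub_tuple x y) <=
  tail_const rho' * expR (- (delta ^+ 2 / (8 * h))) * heat_kernel 8 x *
  heat_kernel (2 * h) (sub_tuple x y).
Proof.
move=> h0 h1 r0 rr d0 xb yb.
have gap := sqr_norm_box_gap d0 xb yb.
have dbl := sqr_norm_le_double x y.
have ny : sqr_norm y <= d%:R * rho' ^+ 2.
  apply: le_trans (sqr_norm_box r0 yb) _.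
  by rewrite ler_wpM2l// ler_pXn2r ?nnegrE// (le_trans r0).
have h20 : 0 < 2 * h by rewrite mulr_gt0.
have -> : heat_kernel h (sub_tuple x y) = 2 `^ (d%:R / 2) *
    (heat_kernel (2 * h) (sub_tuple x y) *
     expR (- (sqr_norm (sub_tuple x y) / (4 * h)))).
  rewrite /heat_kernel -[X in _ = _ * X]mulrA -expRD mulrA; congr (_ * expR _).
    rewrite (_ : 2 * pi * (2 * h) = 2 * (2 * pi * h)); last by ring.
    have ph : 0 <= 2 * pi * h by rewrite !mulr_ge0 ?pi_ge0// ltW.
    rewrite !powRN (powRM _ (ler0n R 2) ph) invfM mulrA divff ?mul1r//.
  by field; rewrite gt_eqF.
rewrite [leRHS](_ : _ = 2 `^ (d%:R / 2) * (heat_kernel (2 * h) (sub_tuple x y) *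
  (expR (d%:R * rho' ^+ 2 / 8) * expR (- (delta ^+ 2 / (8 * h))) *
   expR (- (sqr_norm x / (2 * 8)))))); last first.
  move: (heat_kernel (2 * h) (sub_tuple x y)) => k.
  rewrite /tail_const /heat_kernel powRN.
  have p0 : (2 * pi * 8 : R) `^ (d%:R / 2) != 0.
    by rewrite gt_eqF// powR_gt0// !mulr_gt0// pi_gt0.
  by field.
apply: ler_wpM2l; first exact: powR_ge0.
apply: ler_wpM2l; first exact: heat_kernel_ge0.
rewrite -!expRD ler_expR.
set u := sqr_norm (sub_tuple x y) in gap dbl *.
have u8 : u / 8 <= u / (8 * h).
  apply: ler_wpM2l; first by rewrite (le_trans _ gap)// sqr_ge0.
  by rewrite lef_pV2 ?posrE ?mulr_gt0// ler_piMr.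
have d8 : delta ^+ 2 / (8 * h) <= u / (8 * h).
  by apply: ler_wpM2r => //; rewrite invr_ge0 mulr_ge0// ltW.
have -> : u / (4 * h) = u / (8 * h) + u / (8 * h) by field; rewrite gt_eqF.
lra.
Qed.

Lemma heat_op_off_box (h rho rho' delta : R) x :
  0 < h -> h <= 1 -> 0 <= rho -> rho <= rho' -> 0 <= delta ->
  ~ tuple_box (rho + delta) x ->
  (heat_op h (EFin \o \1_(@tuple_box R d rho)) x <=
   (tail_const rho' * expR (- (delta ^+ 2 / (8 * h))) * heat_kernel 8 x)%:E)%E.
Proof.
move=> h0 h1 r0 rr d0 xb; have h20 : 0 < 2 * h by rewrite mulr_gt0.
set C := tail_const rho' * _ * _.
have C0 : 0 <= C.
  by rewrite !mulr_ge0 ?expR_ge0 ?powR_ge0.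
have mp : measurable_fun [set: E]
    (fun y => (heat_kernel (2 * h) (sub_tuple x y))%:E).
  by apply/measurable_EFinP; exact: measurable_heat_kernel_subr.
have mC : measurable_fun [set: E]
    (fun y => C%:E * (heat_kernel (2 * h) (sub_tuple x y))%:E)%E.
  exact: measurable_funeM.
have -> : C%:E = (\int[lebesgue_tuple d]_y
    (C%:E * (heat_kernel (2 * h) (sub_tuple x y))%:E))%E.
  rewrite ge0_integralZl//; first by rewrite integral_heat_kernel// mule1.
  by move=> y _; rewrite lee_fin heat_kernel_ge0.
have mI : measurable_fun [set: E] (EFin \o (\1_(@tuple_box R d rho) : E -> R)).
  by apply/measurable_EFinP; apply: measurable_indic; exact: measurable_tuple_box.
apply: ge0_le_integral => //.
- by move=> y _; rewrite mule_ge0 ?lee_fin ?heat_kernel_ge0.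
- exact: measurable_heat_op_integrand.
move=> y _; rewrite /= indicE; have [yb|yb] := boolP (y \in tuple_box rho).
  rewrite mule1 -EFinM lee_fin.
  by apply: heat_kernel_off_box xb _ => //; rewrite inE in yb.
by rewrite mule0 -EFinM lee_fin mulr_ge0// heat_kernel_ge0.
Qed.

End gaussian_tail.

(** * Upper bound for the cumulant of a box *)

Section growth.
Context {R : realType}.

Lemma bernoulli_9_8 n : 1 + n%:R / 8 <= (9 / 8 : R) ^+ n.
Proof.
elim: n => [|n IH]; first by rewrite mul0r addr0 expr0.
rewrite exprS -natr1.
have : (0 : R) <= n%:R by rewrite ler0n.
move: (_ ^+ n) (n%:R) IH => a b; lra.
Qed.

Lemma exists_expr_9_8_ge (M : R) : exists n, M <= (9 / 8 : R) ^+ n.+1.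
Proof.
(* Bernoulli's inequality gives at least [1 + (8 M) / 8] *)
exists (Num.truncn (8 * M)).
apply: le_trans (bernoulli_9_8 _); have := truncnS_gt (8 * M).
move: (Num.truncn _).+1%:R => a; lra.
Qed.

(** The exponential series dominates a power of [(9/8)^k] that exceeds [M^k]. *)
Lemma exp_beats_geometric (M : R) : 0 <= M ->
  exists2 D, 0 < D & forall k, M ^+ k * expR (- ((9 / 8) ^+ k / 4)) <= D.
Proof.
move=> M0; have [m hm] := exists_expr_9_8_ge M.
exists (4 ^+ m.+1 * m.+1`!%:R).
  by rewrite mulr_gt0 ?exprn_gt0// ltr0n fact_gt0.
move=> k; rewrite expRN ler_pdivrMr ?expR_gt0//.
have q0 : 0 <= (9 / 8 : R) ^+ k by rewrite exprn_ge0.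
have := @expR_ge1Dxn R ((9 / 8) ^+ k / 4) m (divr_ge0 q0 (ler0n R 4)).
have fm : 0 < (m.+1)`!%:R :> R by rewrite ltr0n fact_gt0.
set z := _ / 4; move=> hz.
have : z ^+ m.+1 <= m.+1`!%:R * expR z.
  rewrite mulrC -ler_pdivrMr//; by apply: le_trans hz; rewrite lerDr.
rewrite -(ler_pM2l (exprn_gt0 m.+1 (ltr0n R 4))) mulrA; apply: le_trans.
rewrite -exprMn (_ : 4 * z = (9 / 8) ^+ k); last by rewrite /z; field.
by rewrite -exprM mulnC exprM lerXn2r ?nnegrE// exprn_ge0.
Qed.

End growth.

Section upper_bound.
Context {R : realType} {d : nat}.
Local Notation E := (d.-tuple R).
Local Notation M := {measure set E -> \bar R}.
Variables (beta : R) (Q : M -> set (R -> M) -> \bar R).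
Hypothesis beta_gt0 : 0 < beta.
Hypothesis HQ : superprocess_laws beta Q.
Local Notation V := (@cumulant R d beta).
Implicit Types (s t : R) (x y : E) (f g : E -> R).

Lemma bounded_test_indic (c : R) (B : set E) : 0 <= c -> measurable B ->
  bounded_test (fun y => c * \1_B y).
Proof.
move=> c0 mB; split.
- by apply: measurable_funM => //; exact: measurable_indic.
- by move=> y; rewrite mulr_ge0// indicE.
- by exists c => y; rewrite ler_piMr// indicE lern1 leq_b1.
Qed.

Lemma bounded_test_restrict f (B : set E) : bounded_test f -> measurable B ->
  bounded_test (fun y => f y * \1_B y).
Proof.
move=> [mf f0 [K fK]] mB; split.
- by apply: measurable_funM => //; exact: measurable_indic.
- by move=> y; rewrite mulr_ge0// indicE.
- by exists K => y; apply: le_trans (fK y); rewrite ler_piMr// indicE lern1 leq_b1.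
Qed.

(** The parts of [f] on and off [B] evolve jointly to less than separately. *)
Lemma cumulant_split f (B : set E) t x : bounded_test f -> measurable B ->
  0 <= t ->
  V f t x <= V (fun y => f y * \1_B y) t x + V (fun y => f y * \1_(~` B) y) t x.
Proof.
move=> bf mB t0.
have {1}-> : f = (fun y => f y * \1_B y + f y * \1_(~` B) y).
  apply/funext => y; rewrite -mulrDr !indicE in_setC.
  by case: (y \in B); rewrite ?addr0 ?add0r mulr1.
apply: (cumulant_subadd HQ) => //; apply: bounded_test_restrict => //.
exact: measurableC.
Qed.

Section box.
Variable K : R.
Hypothesis K0 : 0 <= K.

(** The boxes [tuple_box (rho k)] decrease to [tuple_box K] as the times [h k]
    decrease to [0]; the squared gap over the time grows like [(9/8)^k]. *)
Let rho k : R := K + 4 * (3 / 4) ^+ k.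
Let h k : R := 2^-1 ^+ k.

Let rho_ge0 k : 0 <= rho k.
Proof. by rewrite addr_ge0// mulr_ge0// exprn_ge0. Qed.

Let rho_le k : rho k <= K + 4.
Proof. by rewrite lerD2l ler_piMr// exprn_ile1//; lra. Qed.

Let rhoS k : rho k = rho k.+1 + (3 / 4) ^+ k.
Proof. by rewrite /rho exprS; lra. Qed.

Let h_gt0 k : 0 < h k.
Proof. by rewrite exprn_gt0. Qed.

Let h_le1 k : h k <= 1.
Proof. by rewrite exprn_ile1//; lra. Qed.

Let hS k : h k = h k.+1 + h k.+1.
Proof. by rewrite /h exprS; lra. Qed.

Let gapE k : ((3 / 4) ^+ k) ^+ 2 / (8 * h k.+1) = (9 / 8) ^+ k / 4.
Proof.
rewrite /h exprVn (exprS (2 : R) k) -exprM mulnC exprM.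
have -> : (9 / 8 : R) ^+ k = ((3 / 4) ^+ 2) ^+ k * 2 ^+ k.
  by rewrite -exprMn; congr (_ ^+ k); field.
have : (2 : R) ^+ k != 0 by rewrite expf_neq0.
move: (2 ^+ k) (((3 / 4) ^+ 2) ^+ k) => z u z0; by field.
Qed.

Let c := @tail_const R d (K + 4) * (9 / 8) `^ (d%:R / 2).

Let c_gt0 : 0 < c.
Proof. by rewrite mulr_gt0 ?tail_const_gt0// powR_gt0//; lra. Qed.

Let off_box k (s r delta A : R) x : 0 < s -> s <= 1 -> 0 <= r -> r <= K + 4 ->
  0 <= delta -> A <= delta ^+ 2 / (8 * s) -> ~ tuple_box (r + delta) x ->
  (heat_op s (EFin \o \1_(@tuple_box R d r)) x <=
   (c * expR (- A) * heat_kernel (8 + h k) x)%:E)%E.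
Proof.
move=> s0 s1 r0 rK delta0 hA xr.
apply: le_trans (heat_op_off_box s0 s1 r0 rK delta0 xr) _.
rewrite lee_fin /c.
have := @tail_const_gt0 R d (K + 4); move: (tail_const _) => T T0.
rewrite -[leLHS]mulrA (_ : T * _ * _ * _ = T * (expR (- A) *
  ((9 / 8) `^ (d%:R / 2) * heat_kernel (8 + h k) x))); last by ring.
rewrite ler_pM2l//.
apply: ler_pM; [exact: expR_ge0|exact: heat_kernel_ge0| |].
  by rewrite ler_expR lerN2.
have h0 := h_gt0 k; have h1 := h_le1 k.
have h8 : 0 < 8 + h k by rewrite addr_gt0.
have h88 : 8 <= 8 + h k by rewrite lerDl ltW.
apply: le_trans (heat_kernel_le_dilate x (ltr0n R 8) h88) _.
apply: ler_wpM2r; first exact: heat_kernel_ge0.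
apply: ge0_ler_powR; rewrite ?nnegrE ?divr_ge0// ?(ltW h8)//.
by rewrite ler_pM2r// ?invr_gt0//; lra.
Qed.

Let L : R := 2 `^ beta^-1.

(** The bound of [cumulant_cst_le] at time [h k]. *)
Let m k : R := (beta * h k) `^ (- beta^-1).

Let mE k : m k = beta `^ (- beta^-1) * L ^+ k.
Proof.
rewrite /m (powRM _ (ltW beta_gt0) (ltW (h_gt0 k))); congr (_ * _).
have p2 : 0 <= (2 : R) ^+ k by rewrite exprn_ge0.
rewrite /h exprVn -powR_inv1// -powRrM mulN1r opprK.
by rewrite -(powR_mulrn k (ler0n R 2)) powRAC powR_mulrn// powR_ge0.
Qed.

Let heat_opZ_box (r a s : R) x : 0 <= a ->
  heat_op s (EFin \o (fun y => a * \1_(@tuple_box R d r) y)) x =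
  (a%:E * heat_op s (EFin \o \1_(@tuple_box R d r)) x)%E.
Proof.
move=> a0; rewrite -heat_opZ//.
- apply/measurable_EFinP; apply: measurable_indic.
  exact: measurable_tuple_box.
- by move=> y; rewrite /= lee_fin indicE.
Qed.

(** For each [n] there is a [k] so large that no nonlinearity is needed: the gap
    factor absorbs [n]. *)
Let start (n : R) k x : 0 <= n -> n <= expR ((9 / 8) ^+ k / 4) ->
  ~ tuple_box (rho k) x ->
  V (fun y => n * \1_(@tuple_box R d K) y) (h k) x <= c * heat_kernel (8 + h k) x.
Proof.
move=> n0 nk xk.
have bf := bounded_test_indic n0 (@measurable_tuple_box R d K).
rewrite -lee_fin; apply: le_trans (cumulant_le_heat HQ x bf (h_gt0 k)) _.
rewrite heat_opZ_box//.
have := @off_box k (h k) K (4 * (3 / 4) ^+ k) ((9 / 8) ^+ k / 4) x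
  (h_gt0 k) (h_le1 k) K0.
have K4 : K <= K + 4 by rewrite lerDl.
have g0 : 0 <= 4 * (3 / 4 : R) ^+ k by rewrite mulr_ge0// exprn_ge0.
have ge : (9 / 8) ^+ k / 4 <= (4 * (3 / 4) ^+ k) ^+ 2 / (8 * h k).
  rewrite -gapE (hS k); have hk := h_gt0 k.+1.
  move: (h k.+1) ((3 / 4) ^+ k) hk => a b a0.
  rewrite [leRHS](_ : _ = 8 * (b ^+ 2 / (8 * a))); last first.
    by field; rewrite ?gt_eqF ?addr_gt0.
  rewrite ler_peMl//; last by lra.
  by rewrite divr_ge0 ?sqr_ge0// mulr_ge0// ltW.
move=> /(_ K4 g0 ge xk) hop.
apply: le_trans (lee_wpmul2l _ hop) _; first by rewrite lee_fin.
rewrite -EFinM lee_fin mulrA ler_wpM2r ?heat_kernel_ge0//.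
rewrite mulrCA ger_pMr//.
by rewrite expRN ler_pdivrMr ?expR_gt0// mul1r.
Qed.

(** From time [h k.+1] to time [h k]: the part outside the box keeps the constant
    [A], as the kernels compose, and the part inside contributes [D]. *)
Let step (n D A : R) k : 0 <= n -> 0 <= A ->
  c * m k.+1 * expR (- ((9 / 8) ^+ k / 4)) <= D ->
  (forall x, ~ tuple_box (rho k.+1) x ->
    V (fun y => n * \1_(@tuple_box R d K) y) (h k.+1) x <=
    A * heat_kernel (8 + h k.+1) x) ->
  forall x, ~ tuple_box (rho k) x ->
    V (fun y => n * \1_(@tuple_box R d K) y) (h k) x <=
    (A + D) * heat_kernel (8 + h k) x.
Proof.
move=> n0 A0 HD IH x xk.
have bf := bounded_test_indic n0 (@measurable_tuple_box R d K).
move: (fun y => n * _) IH bf => f IH bf.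
have s0 := h_gt0 k.+1.
rewrite {1}hS (cumulant_flow HQ x bf s0 (ltW s0)).
have bg := cumulant_bounded HQ bf (ltW s0).
have mB := @measurable_tuple_box R d (rho k.+1).
apply: le_trans (cumulant_split x bg mB (ltW s0)) _.
rewrite addrC mulrDl; apply: lerD.
  have bgB := bounded_test_restrict bg (measurableC mB).
  rewrite -lee_fin; apply: le_trans (cumulant_le_heat HQ x bgB s0) _.
  have mp := measurable_heat_kernel (8 + h k.+1) : measurable_fun [set: E] _.
  have s8 : 0 < 8 + h k.+1 by rewrite addr_gt0.
  rewrite (_ : 8 + h k = h k.+1 + (8 + h k.+1)); last by rewrite hS; ring.
  rewrite EFinM -heat_op_kernel// -heat_opZ//; last 2 first.
  - exact/measurable_EFinP.
  - by move=> y; rewrite /= lee_fin heat_kernel_ge0.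
  apply: le_heat_op.
  - by apply/measurable_EFinP; case: bgB.
  - by apply: measurable_funeM; exact/measurable_EFinP.
  - by move=> y; rewrite /= lee_fin; case: bgB.
  move=> y; rewrite /= -EFinM lee_fin indicE in_setC.
  have [yB|yB] := boolP (y \in _).
    by rewrite mulr0 mulr_ge0// heat_kernel_ge0.
  by rewrite mulr1; apply: IH => h'; rewrite mem_set in yB.
have bgB := bounded_test_restrict bg mB.
have m0 : 0 <= m k.+1 by exact: powR_ge0.
rewrite -lee_fin; apply: le_trans (cumulant_le_heat HQ x bgB s0) _.
apply: (@le_trans _ _ (heat_op (h k.+1)
    (EFin \o (fun y => m k.+1 * \1_(@tuple_box R d (rho k.+1)) y)) x)).
  have [mI I0 _] := bounded_test_indic m0 mB.
  apply: le_heat_op.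
  - by apply/measurable_EFinP; case: bgB.
  - exact/measurable_EFinP.
  - by move=> y; rewrite /= lee_fin; case: bgB.
  move=> y; rewrite /= lee_fin; apply: ler_wpM2r; first by rewrite indicE.
  exact: (cumulant_cst_le beta_gt0 HQ).
rewrite heat_opZ_box//.
have g0 : 0 <= (3 / 4 : R) ^+ k by rewrite exprn_ge0.
have ge : (9 / 8) ^+ k / 4 <= ((3 / 4) ^+ k) ^+ 2 / (8 * h k.+1) by rewrite gapE.
rewrite rhoS in xk.
have hop := off_box k s0 (h_le1 _) (rho_ge0 _) (rho_le _) g0 ge xk.
apply: le_trans (lee_wpmul2l _ hop) _; first by rewrite lee_fin.
rewrite -EFinM lee_fin mulrA ler_wpM2r ?heat_kernel_ge0//.
by rewrite mulrA (mulrC _ c).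
Qed.

(** Downward induction from the [k] of [start] to [0] sums the contributions of
    [step] to a bound independent of [n]; near the box the constant bound does. *)
Lemma cumulant_box_gaussian : exists2 C, 0 < C & forall (n : R) x, 0 <= n ->
  V (fun y => n * \1_(@tuple_box R d K) y) 1 x <= C * heat_kernel 9 x.
Proof.
have L0 : 0 < L by exact: powR_gt0.
have b0 : 0 < beta `^ (- beta^-1) by exact: powR_gt0.
have [D D0 HD] := exp_beats_geometric (mulr_ge0 (ler0n R 2) (ltW L0)).
pose D' := c * beta `^ (- beta^-1) * L * D.
have cL0 := mulr_gt0 (mulr_gt0 c_gt0 b0) L0.
have D'0 : 0 < D' := mulr_gt0 cL0 D0.
have HD' k : c * m k.+1 * expR (- ((9 / 8) ^+ k / 4)) <= D' * h k.
  rewrite mE exprS /D' /h exprVn.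
  have p2 : 0 < (2 : R) ^+ k by rewrite exprn_gt0.
  rewrite ler_pdivlMr//.
  rewrite [leLHS](_ : _ = c * beta `^ (- beta^-1) * L *
    ((2 * L) ^+ k * expR (- ((9 / 8) ^+ k / 4)))); last first.
    by move: (expR _) => z; rewrite exprMn; ring.
  by rewrite ler_pM2l ?HD.
have far (n : R) x : 0 <= n -> ~ tuple_box (rho 0) x ->
    V (fun y => n * \1_(@tuple_box R d K) y) (h 0) x <=
    (c + D' * 2) * heat_kernel (8 + h 0) x.
  move=> n0; have [N HN] := exists_expr_9_8_ge (4 * n).
  suff all j : (j <= N.+1)%N -> forall x, ~ tuple_box (rho (N.+1 - j)%N) x ->
      V (fun y => n * \1_(@tuple_box R d K) y) (h (N.+1 - j)%N) x <=
      (c + D' * (2 * (h (N.+1 - j)%N - h N.+1))) * heat_kernel (8 + h (N.+1 - j)%N) x.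
    move=> x0; have := all N.+1 (leqnn _) x; rewrite subnn => /(_ x0) /le_trans.
    apply; apply: ler_wpM2r; first exact: heat_kernel_ge0.
    rewrite lerD2l ler_pM2l//.
    have := h_gt0 N.+1; rewrite {2}/h expr0; lra.
  elim: j => [_ x'|j IH jN].
    rewrite subn0 => x'k; rewrite subrr mulr0 mulr0 addr0; apply: start => //.
    apply: le_trans (expR_ge1Dx _); lra.
  have IHj := IH (ltnW jN); have E1 : (N.+1 - j = (N.+1 - j.+1).+1)%N by rewrite -subSn.
  rewrite E1 in IHj; set k := (N.+1 - j.+1)%N in IHj *.
  have hN : h N.+1 <= h k.+1.
    by rewrite /h ler_wiXn2l//; [lra|rewrite -E1 leq_subr].
  have A0 : 0 <= c + D' * (2 * (h k.+1 - h N.+1)).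
    by rewrite addr_ge0 ?(ltW c_gt0)// mulr_ge0 ?(ltW D'0)// mulr_ge0// subr_ge0.
  move=> x' x'k; have := step n0 A0 (HD' k) IHj x'k; congr (_ <= _ * _).
  by rewrite [in RHS]hS (hS k); ring.
(* a lower bound for [heat_kernel 9] on the outermost box *)
pose y9 := (2 * pi * 9 : R) `^ (- (d%:R / 2)) *
  expR (- (d%:R * (rho 0) ^+ 2 / (2 * 9))).
have y90 : 0 < y9 by rewrite mulr_gt0 ?expR_gt0// powR_gt0// !mulr_gt0// pi_gt0.
pose C := (c + D' * 2) + beta `^ (- beta^-1) / y9.
have byD : 0 < beta `^ (- beta^-1) / y9 by rewrite divr_gt0.
have cD : 0 < c + D' * 2 := addr_gt0 c_gt0 (mulr_gt0 D'0 (ltr0n R 2)).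
exists C; first exact: addr_gt0.
move=> n x n0; have [xb|xb] := pselect (tuple_box (rho 0) x); last first.
  have := far n x n0 xb; rewrite /h expr0 (_ : 8 + 1 = 9); last by ring.
  move/le_trans; apply; apply: ler_wpM2r; first exact: heat_kernel_ge0.
  by rewrite lerDl ltW.
have bf := bounded_test_indic n0 (@measurable_tuple_box R d K).
apply: le_trans (cumulant_cst_le beta_gt0 HQ x bf ltr01) _; rewrite mulr1.
apply: le_trans (_ : beta `^ (- beta^-1) / y9 * heat_kernel 9 x <= _); last first.
  apply: ler_wpM2r; first exact: heat_kernel_ge0.
  by rewrite lerDr ltW.
rewrite mulrAC ler_pdivlMr// ler_pM2l//; apply: ler_wpM2l; first exact: powR_ge0.
rewrite ler_expR lerN2; apply: ler_wpM2r; first by rewrite invr_ge0 mulr_ge0.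
exact: sqr_norm_box.
Qed.

Lemma cumulant_box_le_heat_kernel : exists2 C, 0 < C &
  forall (n t : R) x, 0 <= n -> 0 < t ->
  V (fun y => n * \1_(@tuple_box R d K) y) (t + 1) x <= C * heat_kernel (t + 9) x.
Proof.
have [C C0 HC] := cumulant_box_gaussian; exists C => // n t x n0 t0.
have bf := bounded_test_indic n0 (@measurable_tuple_box R d K).
rewrite (cumulant_flow HQ x bf ltr01 (ltW t0)).
have bg := cumulant_bounded HQ bf ler01.
rewrite -lee_fin; apply: le_trans (cumulant_le_heat HQ x bg t0) _.
have mp := measurable_heat_kernel 9 : measurable_fun [set: E] _.
rewrite EFinM -heat_op_kernel// -heat_opZ ?(ltW C0)//; last 2 first.
- exact/measurable_EFinP.
- by move=> y; rewrite /= lee_fin heat_kernel_ge0.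
apply: le_heat_op.
- by apply/measurable_EFinP; case: bg.
- by apply: measurable_funeM; exact/measurable_EFinP.
- by move=> y; rewrite /= lee_fin; case: bg.
by move=> y; rewrite /= -EFinM lee_fin; exact: HC.
Qed.

End box.
End upper_bound.

(** * Lower bound for the cumulant of the unit box *)

Section lower_bound.
Context {R : realType} {d : nat}.
Local Notation E := (d.-tuple R).
Local Notation M := {measure set E -> \bar R}.
Variables (beta : R) (Q : M -> set (R -> M) -> \bar R).
Hypothesis beta_gt0 : 0 < beta.
Hypothesis d_gt : 2 / beta < d%:R.
Hypothesis HQ : superprocess_laws beta Q.
Local Notation V := (@cumulant R d beta).
Local Notation box1 := (@tuple_box R d 1).
Implicit Types (s t : R) (x y : E).

(** As [|x - y|^2 <= 2 |x|^2 + 2 |y|^2], halving the time absorbs the position of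
    [y] in the box. *)
Lemma heat_op_box1_ge t x : 1 <= t ->
  ((2 ^+ d * 2 `^ (- (d%:R / 2)) * expR (- d%:R) * heat_kernel (t / 2) x)%:E <=
   heat_op t (EFin \o \1_box1) x)%E.
Proof.
move=> t1; have t0 : 0 < t by apply: lt_le_trans t1.
have mB := @measurable_tuple_box R d 1.
have mI : measurable_fun [set: E] (EFin \o (\1_box1 : E -> R)).
  by apply/measurable_EFinP; apply: measurable_indic.
set c := _ * expR _ * _.
have -> : (c%:E = \int[lebesgue_tuple d]_y
    ((2 `^ (- (d%:R / 2)) * expR (- d%:R) * heat_kernel (t / 2) x)%:E *
     (\1_box1 y)%:E))%E.
  rewrite ge0_integralZl//; last first.
    by rewrite lee_fin mulr_ge0 ?heat_kernel_ge0// mulr_ge0 ?expR_ge0// powR_ge0.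
  rewrite integral_indic// setIT lebesgue_tuple_box// -EFinM; congr EFin.
  by rewrite /c -[1 *+ 2]/(2 : R); ring.
apply: ge0_le_integral => //.
- move=> y _; apply: mule_ge0; last by rewrite lee_fin indicE.
  by rewrite lee_fin mulr_ge0 ?heat_kernel_ge0// mulr_ge0 ?expR_ge0// powR_ge0.
- exact: measurable_funeM.
- exact: measurable_heat_op_integrand.
move=> y _; rewrite /= indicE; have [yB|yB] := boolP (y \in box1); last by rewrite !mule0.
rewrite !mule1 lee_fin {}/c.
have ny : sqr_norm y <= d%:R.
  by have := @sqr_norm_box R d 1 y ler01; rewrite expr1n mulr1; apply; rewrite inE in yB.
have nxy : sqr_norm (sub_tuple x y) <= 2 * sqr_norm x + 2 * sqr_norm y.
  rewrite /sqr_norm !mulr_sumr -big_split/=; apply: ler_sum => i _.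
  rewrite /sub_tuple tnth_mktuple; move: (tnth x i) (tnth y i) => a b.
  by rewrite -subr_ge0 (_ : _ - _ = (a + b) ^+ 2) ?sqr_ge0//; ring.
have pt : 0 <= 2 * pi * (t / 2) by rewrite !mulr_ge0 ?pi_ge0 ?invr_ge0// ltW.
rewrite /heat_kernel [2 * pi * t](_ : _ = 2 * (2 * pi * (t / 2))); last by field.
rewrite [in leRHS](powRM _ (ler0n R 2) pt) -!mulrA ler_pM2l ?powR_gt0//.
rewrite mulrCA; apply: ler_wpM2l; first exact: powR_ge0.
rewrite -expRD ler_expR -opprD lerN2.
rewrite ler_pdivrMr ?mulr_gt0// mulrDl.
have -> : sqr_norm x / (2 * (t / 2)) * (2 * t) = 2 * sqr_norm x.
  by field; rewrite gt_eqF.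
apply: le_trans nxy _; rewrite addrC lerD2r.
have d0 : (0 : R) <= d%:R by exact: ler0n.
nra.
Qed.

(** By the hypothesis on [d] this is positive: [(1 + s)^(- (q + 1))], which is up to
    a constant the [beta]-th power of the bound [heat_op_box1_le], is integrable. *)
Let q : R := d%:R / 2 * beta - 1.

Let q_gt0 : 0 < q.
Proof.
rewrite subr_gt0 mulrAC -ltr_pdivrMr// div1r invrK.
by rewrite -ltr_pdivrMr.
Qed.

(** Chosen so that one bound covers [s <= 1], where the semigroup is a contraction,
    and [s >= 1], where it decays like [s^(- d / 2)]. *)
Let C1 : R := 2 ^+ d * 2 `^ (d%:R / 2).

Let C1_gt0 : 0 < C1.
Proof. by rewrite mulr_gt0 ?exprn_gt0// powR_gt0. Qed.

Let d2_ge0 : 0 <= d%:R / 2 :> R.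
Proof. by rewrite divr_ge0. Qed.

Let heat_op_box1_le s x : 0 < s ->
  (heat_op s (EFin \o \1_box1) x <= (C1 * (1 + s) `^ (- (d%:R / 2)))%:E)%E.
Proof.
move=> s0; have mB := @measurable_tuple_box R d 1.
have mI : measurable_fun [set: E] (\1_box1 : E -> R) by apply: measurable_indic.
have s1 : 0 < 1 + s by rewrite addr_gt0.
rewrite powRN; have [sle|slt] := leP s 1.
  apply: (@le_trans _ _ 1%E).
    rewrite -(heat_op_cst x s0 ler01); apply: le_heat_op => //.
    - exact/measurable_EFinP.
    - by move=> y; rewrite lee_fin indicE.
    - by move=> y; rewrite lee_fin indicE lern1 leq_b1.
  rewrite lee_fin ler_pdivlMr ?powR_gt0// mul1r /C1.
  apply: (@le_trans _ _ (2 `^ (d%:R / 2))).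
    apply: ge0_ler_powR; rewrite ?nnegrE// ?(ltW s1)//; lra.
  rewrite ler_peMl ?powR_ge0// exprn_ege1//; lra.
apply: le_trans (le_heat_op_sup x s0 mI _) _; first by move=> y; rewrite indicE.
rewrite integral_indic// setIT lebesgue_tuple_box// -EFinM lee_fin mulrC /C1.
rewrite -[1 *+ 2]/(2 : R) -[leRHS]mulrA; apply: ler_wpM2l; first by rewrite exprn_ge0.
have pi1 : 1 <= pi :> R by rewrite (le_trans _ (pi_ge2 R))//; lra.
have p0 : 0 < 2 * pi * s by rewrite !mulr_gt0// pi_gt0.
rewrite powRN ler_pdivlMr ?powR_gt0// mulrC ler_pdivrMr ?powR_gt0//.
rewrite -?(powRM _ (ler0n R 2) (ltW p0)) -?(powRM _ (ltW p0) (ler0n R 2)).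
apply: ge0_ler_powR; rewrite ?nnegrE ?(ltW s1) ?mulr_ge0 ?pi_ge0 ?(ltW s0)//.
nra.
Qed.

(** Makes [(eps * C1)^beta / q] equal to [1/2]. *)
Let eps : R := (q / 2) `^ beta^-1 / C1.

Let eps_gt0 : 0 < eps.
Proof. by rewrite divr_gt0// powR_gt0// divr_gt0. Qed.

Lemma cumulant_box1_ge : exists2 eps, 0 < eps & exists2 kappa, 0 < kappa &
  forall t x, 1 <= t ->
  kappa * heat_kernel (t / 2) x <= V (fun y => eps * \1_box1 y) t x.
Proof.
exists eps => //; exists (eps * (2 ^+ d * 2 `^ (- (d%:R / 2)) * expR (- d%:R)) / 2).
  by rewrite divr_gt0// mulr_gt0// !mulr_gt0 ?expR_gt0 ?powR_gt0 ?exprn_gt0.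
move=> t x t1; have t0 : 0 < t by apply: lt_le_trans t1.
have mB := @measurable_tuple_box R d 1.
have bf := bounded_test_indic (ltW eps_gt0) mB.
have [mf f0 _] := bf.
have mI : measurable_fun [set: E] (EFin \o (\1_box1 : E -> R)).
  by apply/measurable_EFinP; apply: measurable_indic.
have opE s y : heat_op s (EFin \o (fun y => eps * \1_box1 y)) y =
    (eps%:E * heat_op s (EFin \o \1_box1) y)%E.
  rewrite -heat_opZ ?(ltW eps_gt0)// => z.
  by rewrite /= lee_fin indicE.
pose b (s : R) : R := eps * (C1 * (1 + s) `^ (- (d%:R / 2))).
have mb : measurable_fun [set: measurableTypeR R] b.
  do 2 (apply: measurable_funM => //).
  apply: (@measurableT_comp _ _ _ _ _ _ (@powR R ^~ _)).
    exact: measurable_powR.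
  exact: measurable_funD.
have b0 (s : R) : 0 <= b s.
  by apply: mulr_ge0; [exact: ltW|apply: mulr_ge0; [exact: ltW|exact: powR_ge0]].
have fb (s : R) (y : E) : 0 < s ->
    (heat_op s (EFin \o (fun y => eps * \1_box1 y)%R) y <= (b s)%:E)%E.
  move=> s0; rewrite opE /b [leRHS]EFinM; apply: lee_wpmul2l; first by rewrite lee_fin ltW.
  exact: heat_op_box1_le.
have intb : (\int[lebesgue_measure]_(s in `[0%R, t[) (b s `^ beta)%:E <= 2^-1%:E)%E.
  have bE (s : R) : 0 <= s -> b s `^ beta = q / 2 * (1 + 1 * s) `^ (- (q + 1)).
    move=> s0; have s1 : 0 <= 1 + s by rewrite addr_ge0.
    have eC : 0 <= eps * C1 := mulr_ge0 (ltW eps_gt0) (ltW C1_gt0).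
    rewrite /b mulrA (powRM _ eC (powR_ge0 _ _)).
    rewrite /eps divfK ?gt_eqF// -powRrM mulVf ?gt_eqF// powRr1 ?divr_ge0 ?(ltW q_gt0)//.
    by rewrite -powRrM mul1r; congr (_ * _ `^ _); rewrite /q; ring.
  rewrite [leLHS](_ : _ = (\int[lebesgue_measure]_(s in `[0%R, t[)
      ((q / 2)%:E * ((1 + 1 * s) `^ (- (q + 1)))%:E))%E); last first.
    apply: eq_integral => s; rewrite inE/= in_itv/= => /andP[s0 _].
    by rewrite bE// EFinM.
  rewrite ge0_integralZl//; last 3 first.
  - apply/measurable_EFinP/measurable_funTS.
    apply: (@measurableT_comp _ _ _ _ _ _ (@powR R ^~ _)).
      exact: measurable_powR.
    by apply: measurable_funD => //; exact: measurable_funM.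
  - by move=> s _; rewrite lee_fin powR_ge0.
  - by rewrite lee_fin divr_ge0// ltW.
  rewrite integral_powR_affine// -EFinM lee_fin powR1 !mul1r.
  have p0 := powR_ge0 (1 + t) (- q).
  move: (_ `^ (- q)) p0 => p p0.
  rewrite [leLHS](_ : _ = (1 - p) / 2); first lra.
  by field; rewrite gt_eqF.
have := mild_ge_half_heat beta_gt0 x (cumulant_mild HQ bf) mf f0 t0 mb b0 fb intb.
rewrite opE => h; have := heat_op_box1_ge x t1.
move/(lee_wpmul2l (_ : (0 <= eps%:E)%E)); rewrite lee_fin => /(_ (ltW eps_gt0)).
move=> /le_trans/(_ h); rewrite -EFinM lee_fin; lra.
Qed.

End lower_bound.

(** * Path events and independence *)

Lemma emeasurable_prod {dO : measure_display} {Omega : measurableType dO}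
    {R : realType} (I : Type) (s : seq I) (p : pred I) (f : I -> Omega -> \bar R) :
  (forall i, measurable_fun setT (f i)) ->
  measurable_fun setT (fun w => \prod_(i <- s | p i) f i w)%E.
Proof.
move=> mf; elim: s => [|i s IH].
  by rewrite (_ : (fun _ => _) = cst 1%E)//; apply/funext => w; rewrite big_nil.
rewrite (_ : (fun _ => _) = (fun w => if p i then f i w * \prod_(j <- s | p j) f j w
    else \prod_(j <- s | p j) f j w)%E); last first.
  by apply/funext => w; rewrite big_cons.
by case: (p i) => //; exact: emeasurable_funM.
Qed.

Section path_events.
Context {R : realType} {d : nat}.
Local Notation E := (d.-tuple R).
Local Notation M := {measure set E -> \bar R}.
Context {dO : measure_display} {Omega : measurableType dO}.

(** The sets with measurable preimage form a sigma-algebra. *)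
Lemma measurable_generated_preimage (S : Type) (G : set (set S)) (h : Omega -> S) :
  (forall C, G C -> measurable (h @^-1` C)) ->
  forall C, <<s G >> C -> measurable (h @^-1` C).
Proof.
move=> hG; apply: (@smallest_sub _ (sigma_algebra setT) G
  [set C | measurable (h @^-1` C)]) => //; split.
- by rewrite /= preimage_set0.
- move=> A /= mA; rewrite setTD preimage_setC; exact: measurableC.
- by move=> F mF /=; rewrite preimage_bigcup; apply: bigcup_measurable => k _; exact: mF.
Qed.

Lemma measurable_path_event (X : R -> Omega -> M) (C : set (R -> M)) :
  measurable_process X -> paths_measurable C ->
  measurable [set w | C (X ^~ w)].
Proof.
move=> mX; apply: (@measurable_generated_preimage _ _ (fun w => X ^~ w)).
move=> _ [t [B [Y [t0 mB mY ->]]]].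
by have := mX t B t0 mB measurableT Y mY; rewrite setTI.
Qed.

Lemma measurable_initial_event (X : R -> Omega -> M) (D : set M) :
  measurable_process X -> measures_measurable D ->
  measurable [set w | D (X 0 w)].
Proof.
move=> mX; apply: (@measurable_generated_preimage _ _ (X 0)).
move=> _ [B [Y [mB mY ->]]].
by have := mX 0 B (lexx 0) mB measurableT Y mY; rewrite setTI.
Qed.

Lemma paths_measurable_eval t (B : set E) (Y : set (\bar R)) : 0 <= t ->
  measurable B -> measurable Y -> paths_measurable [set x : R -> M | Y (x t B)].
Proof. by move=> t0 mB mY; apply: sub_gen_smallest; exists t, B, Y. Qed.

Lemma paths_measurable_sigma_algebra :
  sigma_algebra [set: R -> M] (@paths_measurable R d).
Proof. exact: smallest_sigma_algebra. Qed.

Lemma paths_measurable0 : paths_measurable (set0 : set (R -> M)).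
Proof. by have [] := paths_measurable_sigma_algebra. Qed.

End path_events.

Section independence.
Context {R : realType} {d : nat}.
Local Notation E := (d.-tuple R).
Local Notation M := {measure set E -> \bar R}.
Context {dO : measure_display} {Omega : measurableType dO}.
Variables (P : probability Omega R) (X : nat -> R -> Omega -> M).
Hypothesis mX : forall n, measurable_process (X n).
Hypothesis indep : independent_processes P X.
Local Open Scope ereal_scope.

(** Measurability of [phi] on path space, through its superlevel sets. *)
Definition path_functional (phi : (R -> M) -> \bar R) :=
  (forall x, 0 <= phi x) /\
  forall u : R, paths_measurable [set x | u%:E < phi x].

Lemma measurable_path_functional n phi : path_functional phi ->
  measurable_fun setT (fun w => phi (X n ^~ w)).
Proof.
move=> [_ mphi]; apply: (measurability _ (ErealGenOInfty.measurableE R)) => //.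
move=> _ [_ [u ->] <-]; rewrite setTI.
have := measurable_path_event (mX n) (mphi u).
rewrite (_ : mkset _ = (fun w => phi (X n ^~ w)) @^-1` `]u%:E, +oo[)//.
by apply/seteqP; split => w /=; rewrite in_itv/= andbT.
Qed.

Lemma path_functional_indic (C : set (R -> M)) : paths_measurable C ->
  path_functional (fun x => (\1_C x)%:E).
Proof.
move=> mC; split; first by move=> x; rewrite lee_fin indicE.
move=> u; have [s0 sD _] := @paths_measurable_sigma_algebra R d.
have [u0|u0] := ltP u 0%R.
  rewrite (_ : mkset _ = setT `\` set0); first exact: sD.
  rewrite setD0; apply/seteqP; split=> // x _ /=.
  by rewrite lte_fin (lt_le_trans u0)// indicE.
have [u1|u1] := ltP u 1%R.
  rewrite (_ : mkset _ = C)//; apply/seteqP; split => x /=; rewrite lte_fin indicE.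
    by have [|] := boolP (x \in C); [rewrite inE|rewrite ltNge u0].
  by move=> xC; rewrite mem_set.
rewrite (_ : mkset _ = set0)//; apply/seteqP; split=> // x /=.
by rewrite lte_fin ltNge (le_trans _ u1)// indicE lern1 leq_b1.
Qed.

(** Restricting to [u >= 0] in the set itself makes this an integral over the
    whole line, as Tonelli's theorem wants it. *)
Lemma layer_cake (z : \bar R) : 0 <= z ->
  \int[lebesgue_measure]_u (\1_[set u : R | (0 <= u)%R /\ (u%:E < z)%E] u)%:E = z.
Proof.
move=> z0; have [zy|zy] := eqVneq z +oo.
  rewrite zy (_ : mkset _ = `[0%R, +oo[%classic).
    by rewrite integral_indic//= setIT lebesgue_measure_itv/= ltry.
  apply/seteqP; split => u /=; rewrite in_itv/= andbT; first by case.
  by move=> ->; split=> //; rewrite ltry.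
have zf : z \is a fin_num by rewrite ge0_fin_numE// ltey.
rewrite -(fineK zf) (_ : mkset _ = `[0%R, fine z[%classic).
  rewrite integral_indic//= setIT lebesgue_measure_itv/= lte_fin.
  case: ifPn => [_|]; first by rewrite sube0.
  have := fine_ge0 z0; rewrite -leNgt => h1 h2.
  by congr EFin; apply/eqP; rewrite eq_le h1 h2.
apply/seteqP; split => u /=; rewrite in_itv/= lte_fin; first by case=> -> ->.
by move/andP.
Qed.

Lemma expectation_prod_indic n (C : nat -> set (R -> M)) :
  (forall i, paths_measurable (C i)) ->
  \int[P]_w (\prod_(i < n) (\1_(C i) (X i ^~ w))%:E) =
  \prod_(i < n) \int[P]_w (\1_(C i) (X i ^~ w))%:E.
Proof.
move=> mC.
have E1 i : \int[P]_w (\1_(C i) (X i ^~ w))%:E = P [set w | C i (X i ^~ w)].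
  rewrite -[X in _ = _ X]setIT -integral_indic//; last exact: measurable_path_event.
under [RHS]eq_bigr do rewrite E1.
rewrite -indep// -[X in _ = _ X]setIT -integral_indic//; last first.
  rewrite (_ : mkset _ = \bigcap_(i in [set i | (i < n)%N]) [set w | C i (X i ^~ w)])//.
  by apply: bigcap_measurableType => i _; exact: measurable_path_event.
apply: eq_integral => w _; rewrite indicE.
have [h|h] := boolP (w \in _).
  rewrite inE/= in h; rewrite big1// => i _.
  by rewrite indicE mem_set//; exact: h.
have [i [iN nC]] : exists i, (i < n)%N /\ ~ C i (X i ^~ w).
  apply: contrapT => H; move/negP: h; apply; rewrite inE/= => i iN.
  by apply: contrapT => nC; apply: H; exists i.
rewrite (bigD1 (Ordinal iN))//= indicE memNset// mul0e//.
Qed.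

(** By induction, the functionals may be arbitrary below [k] and are indicators
    from [k] on. The functional at [k] is the integral over [u] of the indicators
    of its superlevel sets, for which the product formula is known, and Tonelli's
    theorem moves the integral outside. *)
Lemma expectation_prod n (phi : nat -> (R -> M) -> \bar R) :
  (forall i, path_functional (phi i)) ->
  \int[P]_w (\prod_(i < n) phi i (X i ^~ w)) =
  \prod_(i < n) \int[P]_w phi i (X i ^~ w).
Proof.
suff H k : forall phi : nat -> (R -> M) -> \bar R,
    (forall i, path_functional (phi i)) ->
    (forall i, (k <= i < n)%N -> exists2 C, paths_measurable C &
       phi i = (fun x => (\1_C x)%:E)) ->
    \int[P]_w (\prod_(i < n) phi i (X i ^~ w)) =
    \prod_(i < n) \int[P]_w phi i (X i ^~ w).
  by move=> mphi; apply: (H n) => // i; rewrite ltnNge andbN.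
elim: k => [|k IH] {}phi mphi hphi.
  have /choice[C hC] : forall i, exists C : set (R -> M), (i < n)%N ->
      paths_measurable C /\ phi i = (fun x => (\1_C x)%:E).
    move=> i; have [iN|] := boolP (i < n)%N; last by exists set0.
    by have [C mC E1] := hphi i iN; exists C.
  pose C' i := if (i < n)%N then C i else set0.
  transitivity (\int[P]_w (\prod_(i < n) (\1_(C' i) (X i ^~ w))%:E)).
    apply: eq_integral => w _; apply: eq_bigr => i _.
    by rewrite /C' ltn_ord (hC i (ltn_ord i)).2.
  rewrite expectation_prod_indic.
    apply: eq_bigr => i _; apply: eq_integral => w _.
    by rewrite /C' ltn_ord (hC i (ltn_ord i)).2.
  move=> i; rewrite /C'; case: ifPn => [iN|_]; first exact: (hC i iN).1.
  exact: paths_measurable0.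
have [nk|kn] := leqP n k.
  by apply: IH => // i /andP[ki iN]; move: (leq_trans nk ki); rewrite leqNgt iN.
pose lev (u : R) : set (R -> M) := [set x | (0 <= u)%R /\ u%:E < phi k x].
pose phiu (u : R) i := if i == k then fun x => (\1_(lev u) x)%:E else phi i.
have mlev u : paths_measurable (lev u).
  rewrite /lev; have [u0|u0] := boolP (0 <= u)%R.
    rewrite (_ : mkset _ = [set x | u%:E < phi k x]); first by have [_] := mphi k; exact.
    by apply/seteqP; split => x //= [].
  rewrite (_ : mkset _ = set0); first exact: paths_measurable0.
  by apply/seteqP; split => x //= [].
have mphiu u i : path_functional (phiu u i).
  by rewrite /phiu; case: eqP => _ //; exact: path_functional_indic.
have IHu u : \int[P]_w (\prod_(i < n) phiu u i (X i ^~ w)) =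
    \prod_(i < n) \int[P]_w phiu u i (X i ^~ w).
  apply: IH => // i /andP[ki iN]; rewrite /phiu; case: eqP => [_|/eqP ik].
    by exists (lev u).
  by apply: hphi; rewrite iN andbT ltn_neqAle ki andbT eq_sym.
have phi0 i x : 0 <= phi i x by have [+ _] := mphi i; exact.
have mphiX i := measurable_path_functional i (mphi i).
have layer x : phi k x = \int[lebesgue_measure]_u (\1_(lev u) x : R)%:E.
  rewrite -{1}(layer_cake (phi0 k x)).
  by apply: eq_integral => u _; rewrite !indicE; congr (_%:R%:E); apply/idP/idP; rewrite !inE.
pose K := Ordinal kn.
(* the factors other than the one at [k] *)
pose rest w := \prod_(i < n | i != K) phi i (X i ^~ w).
have rest0 w : 0 <= rest w by apply: prode_ge0 => i _; exact: phi0.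
have mrest : measurable_fun setT rest.
  by apply: emeasurable_prod => i; exact: mphiX.
have mjoint : measurable_fun [set: (measurableTypeR R * Omega)%type]
   (fun p => (\1_(lev p.1) (X k ^~ p.2) : R)%:E).
  apply/measurable_EFinP.
  have -> : (fun p : measurableTypeR R * Omega => \1_(lev p.1) (X k ^~ p.2) : R) =
      \1_([set p : measurableTypeR R * Omega | (0 <= p.1)%R] `&`
          [set p | p.1%:E < phi k (X k ^~ p.2)]).
    by apply/funext => p; rewrite !indicE; congr (_%:R); apply/idP/idP; rewrite !inE.
  apply: measurable_indic; apply: measurableI; rewrite -[X in measurable X]setTI.
    rewrite (_ : mkset _ = fst @^-1` `[0%R, +oo[%classic).
      exact: (@measurable_fst _ _ (measurableTypeR R) Omega).
    by apply/seteqP; split=> p /=; rewrite in_itv/= andbT.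
  apply: measurable_lte => //.
    by apply/measurable_EFinP; exact: measurable_fst.
  exact: (measurableT_comp (mphiX k) measurable_snd).
have split_k (psi : nat -> Omega -> \bar R) w :
    \prod_(i < n) psi i w = psi k w * \prod_(i < n | i != K) psi i w.
  by rewrite (bigD1 K).
pose c := \prod_(i < n | i != K) \int[P]_w phi i (X i ^~ w).
have c0 : 0 <= c.
  by apply: prode_ge0 => i _; apply: integral_ge0 => w _; exact: phi0.
have ind0 u w : 0 <= (\1_(lev u) (X k ^~ w) : R)%:E by rewrite lee_fin indicE.
transitivity (\int[P]_w \int[lebesgue_measure]_u
    ((\1_(lev u) (X k ^~ w) : R)%:E * rest w)).
  apply: eq_integral => w _; rewrite (split_k (fun i w => phi i (X i ^~ w))).
  rewrite -/(rest w) layer ge0_integralZr//.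
  exact: (measurableT_comp mjoint (pair2_measurable w)).
rewrite -(@fubini_tonelli _ _ _ _ R lebesgue_measure P (fun p =>
    (\1_(lev p.1) (X k ^~ p.2) : R)%:E * rest p.2)); first last.
- by move=> p; rewrite mule_ge0.
- apply: emeasurable_funM => //; exact: (measurableT_comp mrest measurable_snd).
transitivity (\int[lebesgue_measure]_u
    ((\int[P]_w (\1_(lev u) (X k ^~ w) : R)%:E) * c)).
  apply: eq_integral => u _ /=.
  transitivity (\int[P]_w \prod_(i < n) phiu u i (X i ^~ w)).
    apply: eq_integral => w _; rewrite (split_k (fun i w => phiu u i (X i ^~ w))).
    rewrite {1}/phiu eqxx; congr (_ * _); apply: eq_bigr => i iK.
    by rewrite /phiu ifN.
  rewrite IHu (bigD1 K)//=; congr (_ * _).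
    by apply: eq_integral => w _; rewrite /phiu eqxx.
  apply: eq_bigr => i iK; apply: eq_integral => w _; by rewrite /phiu ifN.
rewrite ge0_integralZr//; last 2 first.
- apply: (@measurable_fun_fubini_tonelli_F _ _ _ _ R P (fun p : measurableTypeR R * Omega =>
    (\1_(lev p.1) (X k ^~ p.2) : R)%:E)) => // p; exact: ind0.
- by move=> u _; apply: integral_ge0 => w _; exact: ind0.
rewrite (@fubini_tonelli _ _ _ _ R lebesgue_measure P (fun p =>
    (\1_(lev p.1) (X k ^~ p.2) : R)%:E))//.
rewrite (bigD1 K)//=; congr (_ * _); apply: eq_integral => w _.
by rewrite layer.
Qed.

End independence.

(** * Estimates for the laws of the superprocess *)

Section law_estimates.
Context {R : realType} {d : nat}.
Local Notation E := (d.-tuple R).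
Local Notation M := {measure set E -> \bar R}.
Variables (beta : R) (Q : M -> set (R -> M) -> \bar R).
Hypothesis beta_gt0 : 0 < beta.
Hypothesis HQ : superprocess_laws beta Q.
Local Notation V := (@cumulant R d beta).
Implicit Types (s t : R) (x y : E) (mu m : M) (B : set E) (g : E -> R).

Lemma integral_scaled_indic mu (c : R) B : 0 <= c -> measurable B ->
  (\int[mu]_x (c * \1_B x)%:E = c%:E * mu B)%E.
Proof.
move=> c0 mB; under eq_integral do rewrite EFinM.
rewrite ge0_integralZl//.
- by rewrite integral_indic// setIT.
- by apply/measurable_EFinP; exact: measurable_indic.
Qed.

Section single_process.
Context {dO : measure_display} {Omega : measurableType dO}.
Variables (P : probability Omega R) (X : R -> Omega -> M) (m : M).
Hypothesis hX : superprocess_from beta Q P X m.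

Let mX : measurable_process X. Proof. by case: hX => -[]. Qed.

Lemma superprocess_from_laplace_indic (c s : R) B : 0 <= c -> 0 <= s ->
  measurable B ->
  (\int[P]_w expeR (- (c%:E * X s w B)) =
   expeR (- \int[m]_x (V (fun y => c * \1_B y) s x)%:E))%E.
Proof.
move=> c0 s0 mB.
rewrite -(superprocess_from_laplace HQ hX (bounded_test_indic c0 mB) s0).
by apply: eq_integral => w _; rewrite integral_scaled_indic.
Qed.

Lemma measurable_eval_expeR (c s : R) B : 0 <= s -> measurable B ->
  measurable_fun setT (fun w => expeR (- (c%:E * X s w B)))%E.
Proof.
move=> s0 mB; apply: measurableT_comp; first exact: measurable_expeR.
by apply: measurableT_comp => //; apply: measurable_funeM; exact: mX.
Qed.

Lemma measurable_eval_ge (delta s : R) B : 0 <= s -> measurable B ->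
  measurable [set w | (delta%:E <= X s w B)%E].
Proof.
move=> s0 mB; rewrite -[X in measurable X]setTI.
exact: (emeasurable_fun_c_infty measurableT (mX s0 mB)).
Qed.

(** On the event, [exp (- n X_s B)] is at most [eta = exp (- n delta)], so that
    [(1 - eta) P A <= 1 - E exp (- n X_s B)]; by hypothesis the right-hand side is
    at most [m g] for all [n], and [eta] vanishes as [n] grows. *)
Lemma hitting_level_le s B g (delta : R) : 0 <= s -> measurable B ->
  measurable_fun setT g ->
  (forall (n : R) x, 0 <= n -> V (fun y => n * \1_B y) s x <= g x) ->
  0 < delta ->
  (P [set w | delta%:E <= X s w B] <= \int[m]_x (g x)%:E)%E.
Proof.
move=> s0 mB mg Vg d0.
have V0 (n : R) x : 0 <= n -> 0 <= V (fun y => n * \1_B y) s x.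
  by move=> n0; apply: (cumulant_ge0 HQ) => //; exact: bounded_test_indic.
have g0 x : 0 <= g x by apply: le_trans (V0 0 x (lexx 0)) (Vg 0 x (lexx 0)).
set a := (\int[m]_x (g x)%:E)%E.
have a0 : (0 <= a)%E by apply: integral_ge0 => x _; rewrite lee_fin.
have [ay|ay] := eqVneq a +oo%E; first by rewrite ay leey.
have af : a \is a fin_num by rewrite ge0_fin_numE// ltey.
set A := [set w | _].
have mA : measurable A by exact: measurable_eval_ge.
have Pf : P A \is a fin_num by exact: fin_num_measure.
have key (n : R) : 0 <= n -> (1 - expR (- (n * delta))) * fine (P A) <= fine a.
  move=> n0; set eta := expR _.
  have eta1 : eta <= 1 by rewrite expR_le1 oppr_le0 mulr_ge0// ltW.
  have : ((1 - eta)%:E * P A + \int[P]_w expeR (- (n%:E * X s w B)) <= 1)%E.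
    rewrite -[P A](_ : \int[P]_w (\1_A w)%:E = _)%E; last by rewrite integral_indic// setIT.
    have eta0 : (0 <= (1 - eta)%:E)%E by rewrite lee_fin subr_ge0.
    have I0 w : [set: Omega] w -> (0 <= (\1_A w : R)%:E)%E by rewrite lee_fin indicE.
    have mI : measurable_fun [set: Omega] (fun w => (\1_A w : R)%:E).
      by apply/measurable_EFinP; exact: measurable_indic.
    have Z0 w : [set: Omega] w -> (0 <= (1 - eta)%:E * (\1_A w : R)%:E)%E.
      by move=> _; rewrite mule_ge0// I0.
    have mZ : measurable_fun [set: Omega] (fun w => (1 - eta)%:E * (\1_A w : R)%:E)%E.
      exact: measurable_funeM.
    have E0 w : [set: Omega] w -> (0 <= expeR (- (n%:E * X s w B)))%E.
      by move=> _; exact: expeR_ge0.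
    have mE := measurable_eval_expeR n s0 mB.
    rewrite -ge0_integralZl// -ge0_integralD//.
    rewrite -[leRHS](_ : \int[P]_w cst 1 w = 1)%E; last first.
      by rewrite integral_cst// [X in (_ * X)%E]probability_setT mule1.
    apply: ge0_le_integral => //.
    - by move=> w _; rewrite adde_ge0// ?E0// Z0.
    - exact: emeasurable_funD.
    move=> w _ /=; rewrite indicE; have [wA|wA] := boolP (w \in A).
      rewrite inE in wA; rewrite mule1.
      apply: (@le_trans _ _ ((1 - eta)%:E + eta%:E)%E); last first.
        by rewrite -EFinD subrK.
      rewrite leeD2l// -[leRHS]/(expeR (- (n * delta)%:E)) lee_expeR leeN2 EFinM.
      by rewrite lee_wpmul2l ?lee_fin.
    rewrite mule0 add0e -[leRHS]expeR0 lee_expeR oppe_le0 mule_ge0 ?lee_fin//.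
  rewrite (superprocess_from_laplace_indic n0 s0 mB) => h.
  have h2 : (expeR (- a) <= expeR (- \int[m]_x (V (fun y => n * \1_B y)%R s x)%:E))%E.
    rewrite lee_expeR leeN2; apply: ge0_le_integral => //.
    - by move=> x _; rewrite lee_fin V0.
    - apply/measurable_EFinP; apply: (measurable_cumulant HQ) => //.
      exact: bounded_test_indic.
    - exact/measurable_EFinP.
    - by move=> x _; rewrite lee_fin Vg.
  have h3 := le_trans (leeD2l ((1 - eta)%:E * P A)%E h2) h.
  move: h3; rewrite -(fineK af) -(fineK Pf) -EFinM -EFinN /= -EFinD lee_fin.
  by have := expR_ge1Dx (- fine a); lra.
rewrite -(fineK af) -(fineK Pf) lee_fin; apply/ler_addgt0Pr => e e0.
(* then [exp (- n delta) <= 1 / (1 + n delta) <= e] *)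
pose n : R := (e * delta)^-1.
have n0 : 0 <= n by rewrite invr_ge0 mulr_ge0// ltW.
have hn := key n n0.
have : expR (- (n * delta)) <= e.
  rewrite expRN -[leRHS]invrK lef_pV2 ?posrE ?expR_gt0 ?invr_gt0//.
  apply: le_trans (expR_ge1Dx _); rewrite /n invfM mulfVK ?gt_eqF//; lra.
have p0 : 0 <= fine (P A) by exact: fine_ge0.
have p1 : fine (P A) <= 1 by rewrite -lee_fin fineK// probability_le1.
have := expR_ge0 (- (n * delta)).
move: (expR _) hn => z; nra.
Qed.

Lemma hitting_probability_le s B g : 0 <= s -> measurable B ->
  measurable_fun setT g ->
  (forall (n : R) x, 0 <= n -> V (fun y => n * \1_B y) s x <= g x) ->
  (P [set w | 0 < X s w B] <= \int[m]_x (g x)%:E)%E.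
Proof.
move=> s0 mB mg Vg.
pose F (k : nat) := [set w | ((k.+1%:R^-1 : R)%:E <= X s w B)%E].
have -> : [set w | (0 < X s w B)%E] = \bigcup_k F k.
  apply/seteqP; split => w /=; last first.
    by move=> [k _]; apply: lt_le_trans; rewrite lte_fin invr_gt0.
  move=> Xw; have [Xy|Xy] := eqVneq (X s w B) +oo%E.
    by exists 0%N => //; rewrite /F/= Xy leey.
  have Xf : X s w B \is a fin_num by rewrite ge0_fin_numE// ltey.
  have z0 : 0 < fine (X s w B) by rewrite -lte_fin fineK.
  exists (Num.truncn (fine (X s w B))^-1) => //; rewrite /F/= -(fineK Xf) lee_fin.
  rewrite -[leRHS]invrK lef_pV2 ?posrE ?invr_gt0//.
  by apply/ltW; exact: truncnS_gt.
have mF k : measurable (F k) by exact: measurable_eval_ge.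
have ndF : nondecreasing_seq F.
  move=> i j ij; apply/subsetPset => w; rewrite /F/=; apply: le_trans.
  by rewrite lee_fin lef_pV2 ?posrE// ler_nat.
have cvF := @nondecreasing_cvg_mu _ _ _ P F mF (bigcup_measurable (fun k _ => mF k)) ndF.
rewrite -(cvg_lim _ cvF)//; apply: lime_le; first by apply/cvg_ex; eexists; exact: cvF.
by apply: nearW => k; apply: hitting_level_le => //; rewrite invr_gt0.
Qed.

End single_process.

Lemma law_bounds mu C : sigma_finite setT mu -> paths_measurable C ->
  (0 <= Q mu C <= 1)%E.
Proof.
move=> sf mC; have [_ _ Hs] := HQ.
have [dO [Om [P [X [m [_ _ hX _ law]]]]]] := Hs mu sf.
have mw n : measurable_process (X n) by case: (hX n) => -[].
rewrite -law// measure_ge0/= probability_le1//.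
apply: measurable_path_event => // t B t0 mB.
by apply: ge0_emeasurable_sum => // n _; exact: mw.
Qed.

(** Some summand must charge [B]; the bounds of the summands add up to the bound
    for [mu]. *)
Lemma law_hitting_le mu s B g : sigma_finite setT mu -> 0 <= s -> measurable B ->
  measurable_fun setT g ->
  (forall (n : R) x, 0 <= n -> V (fun y => n * \1_B y) s x <= g x) ->
  (Q mu [set x | 0 < x s B] <= \int[mu]_x (g x)%:E)%E.
Proof.
move=> sf s0 mB mg Vg; have [_ _ Hs] := HQ.
have g0 x : 0 <= g x.
  apply: le_trans (Vg 0 x (lexx 0)); apply: (cumulant_ge0 HQ) => //.
  exact: bounded_test_indic.
have [dO [Om [P [X [m [_ mE hX _ law]]]]]] := Hs mu sf.
have mw n : measurable_process (X n) by case: (hX n) => -[].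
have mpos : measurable [set z : \bar R | (0 < z)%E].
  rewrite (_ : mkset _ = `]0%E, +oo[%classic); last first.
    by apply/seteqP; split => z /=; rewrite in_itv/= andbT.
  exact: emeasurable_itv.
rewrite -law; last exact: (paths_measurable_eval s0 mB mpos).
rewrite (@eq_measure_integral _ _ _ _ (mseries m 0)); last by move=> A mA _; rewrite mE.
rewrite ge0_integral_measure_series//; last 2 first.
- by move=> x _; rewrite lee_fin.
- exact/measurable_EFinP.
pose F n := [set w | (0 < X n s w B)%E].
have mF n : measurable (F n).
  by have := mw n s B s0 mB measurableT _ mpos; rewrite setTI.
apply: (@le_trans _ _ (\sum_(n <oo) P (F n))%E); last first.
  apply: lee_nneseries => n _; first by rewrite measure_ge0.
  exact: (hitting_probability_le (hX n)).
apply: measure_sigma_subadditive => //.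
  have mS : measurable_process (fun t w => mseries (fun n => X n t w) 0).
    by move=> t C t0 mC; apply: ge0_emeasurable_sum => // n _; exact: mw.
  by have := mS s B s0 mB measurableT _ mpos; rewrite setTI.
move=> w /= Sw; apply: contrapT => nF; move: Sw; rewrite /mseries.
rewrite eseries0 ?ltxx// => n _ _; apply/eqP; rewrite eq_le measure_ge0 andbT leNgt.
by apply/negP => Fn; apply: nF; exists n.
Qed.

End law_estimates.

Lemma expeRN_sum (R : realType) n (a : nat -> \bar R) : (forall i, 0 <= a i)%E ->
  (expeR (- \sum_(i < n) a i) = \prod_(i < n) expeR (- a i))%E.
Proof.
move=> a0; elim: n => [|n IH]; first by rewrite !big_ord0 oppe0 expeR0.
rewrite !big_ord_recr/= -IH oppeD ?expeRD//.
by rewrite ge0_adde_def// inE// sume_ge0.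
Qed.

Lemma exists_partial_sum_ge (R : realType) (a : nat -> \bar R) (eta : R) :
  (forall i, 0 <= a i)%E -> 0 <= eta -> (eta%:E <= \sum_(i <oo) a i)%E ->
  exists n, ((eta / 2)%:E <= \sum_(i < n) a i)%E.
Proof.
move=> a0; rewrite le_eqVlt => /predU1P[<- _|eta0 eta_le].
  by exists 0%N; rewrite mul0r big_ord0.
apply: contrapT => H; have : (\sum_(i <oo) a i <= (eta / 2)%:E)%E.
  apply: lime_le; first by apply: is_cvg_nneseries => n _ _.
  apply: nearW => n; rewrite big_mkord leNgt; apply/negP => /ltW h.
  by apply: H; exists n.
by move=> /(le_trans eta_le); rewrite lee_fin; lra.
Qed.

Section law_lower_estimate.
Context {R : realType} {d : nat}.
Local Notation E := (d.-tuple R).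
Local Notation M := {measure set E -> \bar R}.
Variables (beta : R) (Q : M -> set (R -> M) -> \bar R).
Hypothesis HQ : superprocess_laws beta Q.
Local Notation V := (@cumulant R d beta).
Implicit Types (s t : R) (x y : E) (mu m : M) (B : set E) (g : E -> R).

Lemma path_functional_expeR (c s : R) B : 0 <= c -> 0 <= s -> measurable B ->
  path_functional (fun x : R -> M => expeR (- (c%:E * x s B)))%E.
Proof.
move=> c0 s0 mB; split=> [x|u]; first exact: expeR_ge0.
apply: (@paths_measurable_eval _ _ s B
  [set z | (u%:E < expeR (- (c%:E * z)))%E]) => //.
rewrite -[X in measurable X]setTI; apply: measurable_lte => //.
apply: measurableT_comp; first exact: measurable_expeR.
by apply: measurableT_comp => //; exact: measurable_funeM.
Qed.

(** By Markov's inequality for [exp (- c S)], where [S] is the mass of finitely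
    many summands, which carry at least half of [eta]. *)
Lemma law_small_mass_le mu s B g (c e eta : R) : sigma_finite setT mu ->
  0 <= s -> measurable B -> 0 <= c -> 0 <= e -> 0 <= eta ->
  measurable_fun setT g -> (forall x, 0 <= g x) ->
  (forall x, g x <= V (fun y => c * \1_B y) s x) ->
  (eta%:E <= \int[mu]_x (g x)%:E)%E ->
  (1 - (expR (c * e - eta / 2))%:E <= Q mu [set x | e%:E <= x s B])%E.
Proof.
move=> sf s0 mB c0 e0 eta0 mg g0 gV; have [_ _ Hs] := HQ.
have [dO [Om [P [X [m [_ mE hX indep law]]]]]] := Hs mu sf.
have mw n : measurable_process (X n) by case: (hX n) => -[].
have mge : measurable [set z : \bar R | (e%:E <= z)%E].
  rewrite (_ : mkset _ = `[e%:E, +oo[%classic); last first.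
    by apply/seteqP; split => z /=; rewrite in_itv/= andbT.
  exact: emeasurable_itv.
rewrite -law; last exact: (paths_measurable_eval s0 mB mge).
rewrite (@eq_measure_integral _ _ _ _ (mseries m 0)); last by move=> A mA _; rewrite mE.
have gE0 x : [set: E] x -> (0 <= (g x)%:E)%E by move=> _; rewrite lee_fin.
have mgE : measurable_fun [set: E] (fun x => (g x)%:E) by exact/measurable_EFinP.
rewrite ge0_integral_measure_series//.
move=> /exists_partial_sum_ge[]//; first by move=> i; exact: integral_ge0.
move=> N hN.
set A := [set w | _].
have mA : measurable A.
  have mS : measurable_process (fun t w => mseries (fun n => X n t w) 0).
    by move=> t C t0 mC; apply: ge0_emeasurable_sum => // n _; exact: mw.
  by have := mS s B s0 mB measurableT _ mge; rewrite setTI.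
pose phi (n : nat) (x : R -> M) := (expeR (- (c%:E * x s B)))%E.
have hphi n : path_functional (phi n) by exact: path_functional_expeR.
have bf := bounded_test_indic c0 mB.
(* the Laplace transform of the mass that the first [N] summands put on [B] *)
have hprod : (\int[P]_w (\prod_(i < N) phi i (X i ^~ w)) <= (expR (- (eta / 2)))%:E)%E.
  rewrite (expectation_prod mw indep N hphi).
  apply: (@le_trans _ _ (\prod_(i < N) expeR (- \int[m i]_x (g x)%:E))%E); last first.
    rewrite -(expeRN_sum N (fun i => integral_ge0 (m i) gE0)).
    by rewrite -[leRHS]/(expeR (- (eta / 2)%:E)) lee_expeR leeN2.
  apply: (@proj2 (0 <= \prod_(i < N) \int[P]_w phi i (X i ^~ w))%E).
  elim/big_ind2 : _ => //.
    by move=> x1 x2 y1 y2 [h1 h2] [h3 h4]; split; [exact: mule_ge0|exact: lee_pmul].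
  move=> i _; split; first by apply: integral_ge0 => w _; exact: expeR_ge0.
  rewrite (superprocess_from_laplace_indic HQ (hX i) c0 s0 mB).
  rewrite lee_expeR leeN2; apply: ge0_le_integral => //.
  - by apply/measurable_EFinP; exact: (measurable_cumulant HQ).
  - by move=> x _; rewrite lee_fin.
have cE0 : (0 <= c%:E)%E by rewrite lee_fin.
have Pf : P A \is a fin_num by exact: fin_num_measure.
have mCA := measurableC mA.
have hC : ((expR (- (c * e)))%:E * P (~` A) <= (expR (- (eta / 2)))%:E)%E.
  apply: le_trans hprod; rewrite -[P (~` A)](_ : \int[P]_w (\1_(~` A) w)%:E = _)%E; last first.
    by rewrite integral_indic// setIT.
  have mI : measurable_fun [set: Om] (fun w => (\1_(~` A) w : R)%:E).
    by apply/measurable_EFinP; exact: measurable_indic.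
  have I0 w : [set: Om] w -> (0 <= (\1_(~` A) w : R)%:E)%E by rewrite lee_fin indicE.
  rewrite -ge0_integralZl ?lee_fin ?expR_ge0//.
  apply: ge0_le_integral => //.
  - exact: measurable_funeM.
  - by apply: emeasurable_prod => i; exact: (measurable_path_functional mw).
  move=> w _; rewrite indicE in_setC; have [wA|wA] := boolP (w \in A).
    by rewrite mule0; apply: prode_ge0 => i _; exact: expeR_ge0.
  rewrite mule1 -(expeRN_sum N (fun i => mule_ge0 cE0 (measure_ge0 (X i s w) B))).
  rewrite -[leLHS]/(expeR (- (c * e)%:E)) lee_expeR leeN2.
  rewrite -ge0_sume_distrr//.
  rewrite EFinM lee_wpmul2l ?lee_fin//.
  move: wA; rewrite notin_setE /A/= => /negP; rewrite -ltNge => /ltW.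
  apply: le_trans; rewrite /mseries -(big_mkord xpredT (fun i => X i s w B)).
  exact: nneseries_lim_ge.
have hA : (P A + P (~` A) = 1)%E by rewrite probability_setC// addeC subeK.
have PCf : P (~` A) \is a fin_num by exact: fin_num_measure.
have {}hA : fine (P A) + fine (P (~` A)) = 1.
  by apply: EFin_inj; rewrite EFinD !fineK.
move: hC; rewrite -(fineK PCf) -EFinM lee_fin => hC.
rewrite -(fineK Pf) -EFinB lee_fin.
have : fine (P (~` A)) <= expR (c * e - eta / 2).
  by rewrite expRD -ler_pdivrMl ?expR_gt0// -expRN.
lra.
Qed.

End law_lower_estimate.

(** * Random initial measure *)

Lemma cvg_to0_in_probabilityP (R : realType) (dO : measure_display)
    (Omega : measurableType dO) (P : probability Omega R)
    (Z : R -> Omega -> \bar R) :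
  cvg_to0_in_probability P Z <->
  forall e r : R, 0 < e -> 0 < r -> exists A : R, forall t, A < t ->
    (P [set w | (e%:E <= `|Z t w|)%E] <= r%:E)%E.
Proof.
split=> [H e r e0 r0|H e e0].
  have /fine_cvgP[[A1 [_ h1]] /cvgrPdist_le/(_ r r0)[A2 [_ h2]]] := H e e0.
  exists (Num.max A1 A2) => t; rewrite gt_max => /andP[/h1 fin /h2/=].
  rewrite sub0r normrN => h; rewrite -(fineK fin) lee_fin.
  exact: le_trans (ler_norm _) h.
have fin t r : (P [set w | (e%:E <= `|Z t w|)%E] <= r%:E)%E ->
    P [set w | (e%:E <= `|Z t w|)%E] \is a fin_num.
  by move=> h; rewrite ge0_fin_numE// (le_lt_trans h)// ltry.
apply/fine_cvgP; split.
  have [A hA] := H e 1 e0 ltr01; exists A; split; first exact: num_real.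
  by move=> t /hA; exact: fin.
apply/cvgrPdist_le => r r0; have [A hA] := H e r e0 r0.
exists A; split; first exact: num_real.
move=> t /hA h /=; rewrite sub0r normrN ger0_norm ?fine_ge0//.
by rewrite -lee_fin fineK// (fin _ _ h).
Qed.

(** For [0 < e <= 1] the event that the indicator is at least [e] is [S t]. *)
Lemma cvg_indic_to0_in_probabilityP (R : realType) (dO : measure_display)
    (Omega : measurableType dO) (P : probability Omega R)
    (S : R -> set Omega) :
  cvg_to0_in_probability P (fun t w => (\1_(S t) w)%:E) <->
  forall r : R, 0 < r -> exists A : R, forall t, A < t -> (P (S t) <= r%:E)%E.
Proof.
have SE (e : R) t : 0 < e -> e <= 1 ->
    [set w | (e%:E <= `|(\1_(S t) w)%:E|)%E] = S t.
  move=> e0 e1; apply/seteqP; split => w /=; rewrite indicE.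
    by have [wS _|_] := boolP (w \in S t);
      [rewrite inE in wS|rewrite normr0 lee_fin leNgt e0].
  by move=> wS; rewrite mem_set// normr1.
split=> [/cvg_to0_in_probabilityP H r r0|H].
  have [A hA] := H 1 r ltr01 r0; exists A => t /hA.
  by rewrite (SE 1 t ltr01 (lexx 1)).
apply/cvg_to0_in_probabilityP => e r e0 r0.
have [A hA] := H r r0; exists A => t /hA h.
have [e1|e1] := leP e 1; first by rewrite (SE e t e0 e1).
rewrite (_ : mkset _ = set0) ?measure0 ?lee_fin ?(ltW r0)//.
apply/seteqP; split => // w /=; rewrite indicE lee_fin leNgt.
by case: (_ \in _); rewrite ?normr1 ?e1// normr0 e0.
Qed.

Section mixture.
Context {R : realType} {d : nat} {dO : measure_display} {Omega : measurableType dO}.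
Local Notation E := (d.-tuple R).
Local Notation M := {measure set E -> \bar R}.
Variables (beta : R) (Q : M -> set (R -> M) -> \bar R).
Variables (P : probability Omega R) (xi : R -> Omega -> M).
Hypothesis HQ : superprocess_laws beta Q.
Hypothesis mxi : measurable_process xi.
Hypothesis sxi : forall w, sigma_finite setT (xi 0 w).
Hypothesis cond : conditional_path_law P xi Q.

(** Only the restriction of the kernel to sigma-finite measures is measurable,
    which suffices as all the initial measures are. *)
Lemma measurable_law C : paths_measurable C ->
  measurable_fun setT (fun w => Q (xi 0 w) C).
Proof.
move=> mC _ Y mY; rewrite setTI; have [kerQ _ _] := HQ.
have [D mD hD] := kerQ C Y mC mY.
rewrite (_ : _ @^-1` _ = [set w | D (xi 0 w)]); first exact: (measurable_initial_event mxi mD).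
by apply/seteqP; split => w /=; rewrite (hD _ (sxi w)).
Qed.

Lemma path_law_mixture C : paths_measurable C ->
  (P [set w | C (xi ^~ w)] = \int[P]_w Q (xi 0 w) C)%E.
Proof.
move=> mC; have [D0 DC _] := smallest_sigma_algebra setT
  [set D | exists (B : set E) (Y : set (\bar R)),
        [/\ measurable B, measurable Y & D = [set mu : M | Y (mu B)]]].
have mT : measures_measurable (setT : set M).
  by have := DC _ D0; rewrite setD0.
have := cond mT mC; rewrite (_ : [set w | [set: M] (xi 0 w)] = setT) => [<-|].
  by congr (P _); apply/seteqP; split => w /=; [|case].
by apply/seteqP.
Qed.

Lemma measurable_mass t (B : set E) (Y : set (\bar R)) : 0 <= t ->
  measurable B -> measurable Y -> measurable [set w | Y (xi t w B)].
Proof.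
by move=> t0 mB mY; have := mxi t0 mB measurableT mY; rewrite setTI.
Qed.

Lemma measurable_ereal_gt (a : \bar R) : measurable [set z : \bar R | (a < z)%E].
Proof.
rewrite (_ : mkset _ = `]a, +oo[%classic); first exact: emeasurable_itv.
by apply/seteqP; split => z /=; rewrite in_itv/= andbT.
Qed.

Lemma measurable_ereal_ge (a : \bar R) : measurable [set z : \bar R | (a <= z)%E].
Proof.
rewrite (_ : mkset _ = `[a, +oo[%classic); first exact: emeasurable_itv.
by apply/seteqP; split => z /=; rewrite in_itv/= andbT.
Qed.

Lemma measurable_heat_mass t :
  measurable_fun setT (fun w => \int[xi 0 w]_x (heat_kernel t x)%:E)%E.
Proof.
apply: (measurable_process_integral mxi (lexx 0)).
  by apply/measurable_EFinP; exact: measurable_heat_kernel.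
by move=> x; rewrite lee_fin heat_kernel_ge0.
Qed.

Lemma heat_mass_ge0 t w : (0 <= \int[xi 0%R w]_x (heat_kernel t x)%:E)%E.
Proof. by apply: integral_ge0 => x _; rewrite lee_fin heat_kernel_ge0. Qed.

Definition heat_event t (a : R) :=
  [set w | (a%:E <= \int[xi 0%R w]_x (heat_kernel t x)%:E)%E].

Lemma measurable_heat_event t a : measurable (heat_event t a).
Proof.
rewrite -[X in measurable X]setTI.
exact: (measurable_heat_mass t measurableT (measurable_ereal_ge a%:E)).
Qed.

(** Off the event, the initial measure has heat mass less than [a] and
    [law_hitting_le] applies; on the event the probability is bounded by [1]. *)
Lemma hitting_le_heat_event (C a t s : R) (B : set E) : 0 < C -> 0 <= a ->
  0 <= t -> measurable B ->
  (forall (n : R) x, 0 <= n ->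
    cumulant beta (fun y => n * \1_B y) t x <= C * heat_kernel s x) ->
  (P [set w | 0 < xi t w B] <= P (heat_event s a) + (C * a)%:E)%E.
Proof.
move=> C0 a0 t0 mB hC.
have mS := paths_measurable_eval t0 mB (measurable_ereal_gt 0).
have mH := measurable_heat_event s a.
have CA0 : (0 <= (C * a)%:E)%E by rewrite lee_fin mulr_ge0// ltW.
rewrite (path_law_mixture mS).
have -> : (P (heat_event s a) + (C * a)%:E =
    \int[P]_w ((\1_(heat_event s a) w : R)%:E + (C * a)%:E))%E.
  rewrite ge0_integralD//.
  - rewrite integral_indic// setIT integral_cst//.
    by rewrite [X in (_ + _ * X)%E]probability_setT mule1.
  - by apply/measurable_EFinP; exact: measurable_indic.
have mheat : measurable_fun [set: E] (fun x => C * heat_kernel s x).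
  by apply: measurable_funM => //; exact: measurable_heat_kernel.
apply: ge0_le_integral => //.
- by move=> w _; have /andP[] := law_bounds HQ (sxi w) mS.
- exact: measurable_law.
- apply: emeasurable_funD => //.
  by apply/measurable_EFinP; exact: measurable_indic.
move=> w _; rewrite indicE; have [wH|wH] := boolP (w \in heat_event s a).
  have /andP[_ h1] := law_bounds HQ (sxi w) mS.
  by apply: le_trans h1 _; rewrite leeDl.
rewrite add0e.
apply: le_trans (law_hitting_le HQ (sxi w) t0 mB mheat hC) _.
under eq_integral do rewrite EFinM.
have mk : measurable_fun [set: E] (fun x => (heat_kernel s x)%:E).
  by apply/measurable_EFinP; exact: measurable_heat_kernel.
have k0 x : [set: E] x -> (0 <= (heat_kernel s x)%:E)%E.
  by rewrite lee_fin heat_kernel_ge0.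
have C0E : (0 <= C%:E)%E by rewrite lee_fin ltW.
rewrite ge0_integralZl//.
rewrite EFinM lee_wpmul2l ?lee_fin ?(ltW C0)//.
by move: wH; rewrite notin_setE /heat_event/= => /negP; rewrite -ltNge => /ltW.
Qed.

Lemma heat_event_le_mass (c e a kappa t s : R) (B : set E) : 0 <= c -> 0 <= e ->
  0 <= a -> 0 < kappa -> 0 <= t -> measurable B ->
  (forall x, kappa * heat_kernel s x <= cumulant beta (fun y => c * \1_B y) t x) ->
  ((1 - expR (c * e - kappa * a / 2))%:E * P (heat_event s a) <=
    P [set w | e%:E <= xi t w B])%E.
Proof.
move=> c0 e0 a0 k0 t0 mB hV.
have mS := paths_measurable_eval t0 mB (measurable_ereal_ge e%:E).
have mH := measurable_heat_event s a.
set b := 1 - _.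
rewrite (path_law_mixture mS).
have hQ0 w : (0 <= Q (xi 0 w) [set x | e%:E <= x t B])%E.
  by have /andP[] := law_bounds HQ (sxi w) mS.
have [b0|b0] := leP b 0.
  apply: (@le_trans _ _ 0%E); last by apply: integral_ge0 => w _; exact: hQ0.
  by apply: mule_le0_ge0; [rewrite lee_fin|exact: measure_ge0].
rewrite -[P (heat_event s a)](_ : \int[P]_w (\1_(heat_event s a) w)%:E = _)%E; last first.
  by rewrite integral_indic// setIT.
have mI : measurable_fun [set: Omega] (fun w => (\1_(heat_event s a) w : R)%:E).
  by apply/measurable_EFinP; exact: measurable_indic.
have I0 w : [set: Omega] w -> (0 <= (\1_(heat_event s a) w : R)%:E)%E.
  by rewrite lee_fin indicE.
have bE0 : (0 <= b%:E)%E by rewrite lee_fin ltW.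
rewrite -ge0_integralZl//.
apply: ge0_le_integral => //.
- by move=> w Tw; apply: mule_ge0 => //; exact: I0.
- exact: measurable_funeM.
- exact: measurable_law.
move=> w _; rewrite indicE; have [wH|wH] := boolP (w \in heat_event s a); last first.
  by rewrite mule0; exact: hQ0.
rewrite mule1.
have mg : measurable_fun [set: E] (fun x => kappa * heat_kernel s x).
  by apply: measurable_funM => //; exact: measurable_heat_kernel.
have g0 (x : E) : 0 <= kappa * heat_kernel s x by rewrite mulr_ge0 ?heat_kernel_ge0// ltW.
have ka0 : 0 <= kappa * a by rewrite mulr_ge0// ltW.
rewrite /b EFinB; apply: (law_small_mass_le HQ (sxi w) t0 mB c0 e0 ka0 mg g0 hV).
under eq_integral do rewrite EFinM.
have mk : measurable_fun [set: E] (fun x => (heat_kernel s x)%:E).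
  by apply/measurable_EFinP; exact: measurable_heat_kernel.
have k00 : (0 <= kappa%:E)%E by rewrite lee_fin ltW.
have hk0 x : [set: E] x -> (0 <= (heat_kernel s x)%:E)%E.
  by rewrite lee_fin heat_kernel_ge0.
rewrite ge0_integralZl//.
by rewrite EFinM lee_wpmul2l//; rewrite inE in wH.
Qed.

End mixture.

Theorem theorem3p3 (R : realType) (d : nat) (beta : R)
    (dO : measure_display) (Omega : measurableType dO)
    (P : probability Omega R)
    (xi : R -> Omega -> {measure set (d.-tuple R) -> \bar R})
    (beta_gt0 : 0 < beta) (beta_lt1 : beta < 1) (d_gt : 2 / beta < d%:R)
    (xi_superprocess : superprocess beta P xi)
    (xi_locally_finite : locally_finite_process P xi) :
  let xi_to_0 := forall B : set (d.-tuple R),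
    measurable B -> bounded_tuple_set B ->
    cvg_to0_in_probability P (fun t w => xi t w B) in
  let supp_xi_to_empty := forall B : set (d.-tuple R),
    measurable B -> bounded_tuple_set B ->
    cvg_to0_in_probability P
      (fun t w => (\1_[set w' | (0 < xi t w' B)%E] w)%:E) in
  let heat_to_0 :=
    cvg_to0_in_probability P
      (fun t w => \int[xi 0%R w]_x (heat_kernel t x)%:E)%E in
  (xi_to_0 <-> supp_xi_to_empty) /\ (supp_xi_to_empty <-> heat_to_0).
Proof.
move=> xi_to_0 supp_xi_to_empty heat_to_0.
have [Q HQ [mxi sxi cond]] := xi_superprocess.
have heatE t a : [set w | (a%:E <= `|\int[xi 0%R w]_x (heat_kernel t x)%:E|)%E] =
    heat_event xi t a.
  by apply/seteqP; split => w; rewrite /heat_event/= gee0_abs// heat_mass_ge0.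
have supp_mass : supp_xi_to_empty -> xi_to_0.
  move=> H B mB bB; apply/cvg_to0_in_probabilityP => e r e0 r0.
  have [A hA] := (cvg_indic_to0_in_probabilityP P _).1 (H B mB bB) r r0.
  exists (Num.max A 0) => t; rewrite gt_max => /andP[At t0].
  apply: le_trans (hA t At); apply: le_measure; rewrite ?inE.
  - rewrite (_ : mkset _ = [set w | (e%:E <= xi t w B)%E]).
      exact: (measurable_mass mxi (ltW t0) mB (measurable_ereal_ge e%:E)).
    by apply/seteqP; split => w /=; rewrite gee0_abs.
  - exact: (measurable_mass mxi (ltW t0) mB (measurable_ereal_gt 0)).
  by move=> w /=; rewrite gee0_abs//; apply: lt_le_trans; rewrite lte_fin.
have heat_supp : heat_to_0 -> supp_xi_to_empty.
  move=> H B mB [K0 bB].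
  (* the bound of [B] may be negative when [B] is empty *)
  pose K := Num.max K0 0.
  have K_ge0 : 0 <= K by rewrite le_max lexx orbT.
  have BK : B `<=` tuple_box K.
    by move=> x Bx i; rewrite le_max (bB x Bx i).
  have [C C0 hC] := cumulant_box_le_heat_kernel beta_gt0 HQ K_ge0.
  apply/cvg_indic_to0_in_probabilityP => r r0.
  have a0 : 0 < r / 2 / C by rewrite !divr_gt0.
  have r20 : 0 < r / 2 by rewrite divr_gt0.
  have [A hA] := (cvg_to0_in_probabilityP P _).1 H _ _ a0 r20.
  exists (Num.max A 1) => t'; rewrite gt_max => /andP[At' t'1].
  have t0 : 0 < t' - 1 by rewrite subr_gt0.
  have t'0 : 0 <= t' by rewrite ltW// (lt_trans ltr01).
  have A9 : A < t' - 1 + 9 by lra.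
  have hB (n : R) x : 0 <= n ->
      cumulant beta (fun y => n * \1_B y) t' x <= C * heat_kernel (t' - 1 + 9) x.
    move=> n0; have := hC n _ x n0 t0; rewrite subrK; apply: le_trans.
    apply: (le_cumulant HQ) => //; try exact: bounded_test_indic.
      by apply: bounded_test_indic => //; exact: measurable_tuple_box.
    move=> y; apply: ler_wpM2l => //; rewrite !indicE ler_nat.
    have [yB|//] := boolP (y \in B); rewrite inE in yB.
    by rewrite mem_set//; exact: BK.
  apply: le_trans (hitting_le_heat_event HQ mxi sxi cond C0 (ltW a0) t'0 mB hB) _.
  have := hA _ A9; rewrite heatE => /leeD2r/le_trans; apply.
  rewrite -EFinD lee_fin [C * _]mulrC divfK ?gt_eqF//; lra.
have mass_heat : xi_to_0 -> heat_to_0.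
  move=> H.
  have [c c0 [kappa k0 hV]] := cumulant_box1_ge beta_gt0 d_gt HQ.
  apply/cvg_to0_in_probabilityP => a r a0 r0.
  (* half of the exponent [kappa * a / 2] gained is spent on [c * e] *)
  pose e := kappa * a / 4 / c.
  have e0 : 0 < e by rewrite !divr_gt0// mulr_gt0.
  pose b := 1 - expR (c * e - kappa * a / 2).
  have b0 : 0 < b.
    rewrite subr_gt0 expR_lt1 /e [c * _]mulrC divfK ?gt_eqF//.
    have := mulr_gt0 k0 a0; lra.
  have mB := @measurable_tuple_box R d 1.
  have bB : bounded_tuple_set (@tuple_box R d 1) by exists 1.
  have rb0 : 0 < b * r by rewrite mulr_gt0.
  have [A hA] := (cvg_to0_in_probabilityP P _).1 (H _ mB bB) _ _ e0 rb0.
  exists (Num.max A 1) => t; rewrite gt_max => /andP[At t1].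
  have t2 : 1 <= 2 * t by lra.
  have t20 : 0 <= 2 * t by lra.
  have A2 : A < 2 * t by lra.
  have hV' x : kappa * heat_kernel t x <=
      cumulant beta (fun y => c * \1_(@tuple_box R d 1) y) (2 * t) x.
    by have := hV (2 * t) x t2; rewrite [2 * t / 2]mulrC mulKf.
  have := heat_event_le_mass HQ mxi sxi cond (ltW c0) (ltW e0) (ltW a0) k0 t20 mB hV'.
  rewrite -/b => h1; have := hA _ A2.
  rewrite (_ : mkset _ = [set w | (e%:E <= xi (2 * t)%R w (tuple_box 1))%E]); last first.
    by apply/seteqP; split => w /=; rewrite gee0_abs.
  move=> /(le_trans h1); rewrite heatE EFinM lee_pmul2l ?lte_fin//.
by split; split => // h; [apply/heat_supp/mass_heat|apply/mass_heat/supp_mass].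
Qed.
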